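(* Let $\mathfrak g$ be a seven-dimensional complex Lie algebra which admits a (complex) codimension one Abelian ideal $\mathfrak u$. Let $e_7\in\mathfrak g\setminus\mathfrak u$ and let $\omega\in\Lambda^2\mathfrak u^*$ be a non-degenerate two-form on $\mathfrak u$. Then the following are equivalent: (a) $\mathfrak g$ admits a cocalibrated $(\mathrm G_2)_{\mathbb C}$-structure such that the subspace $\mathfrak u$ is non-degenerate with respect to the induced non-degenerate complex symmetric bilinear form on $\mathfrak g$. (b) $\mathrm{ad}(e_7)|_{\mathfrak u}\in\mathfrak{gl}(\mathfrak u)$ is similar under $\mathrm{GL}(\mathfrak u)$ to an element of $\mathfrak{sp}(\mathfrak u,\omega)$. (c) The complex Jordan normal form of $\mathrm{ad}(e_7)|_{\mathfrak u}$ has the property that for all $m\in\mathbb N$ and all $\lambda\neq 0$ the number of Jordan blocks of size $m$ with $\lambda$ on the diagonal is the same as the number of Jordan blocks of size $m$ with $-\lambda$ on the diagonal, and (for all $m\in\mathbb N$) the number of Jordan blocks of size $2m-1$ with $0$ on the diagonal is even.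
   Context: Write $E^{ijk}=E^i\wedge E^j\wedge E^k$ etc. Let $W$ be a seven-dimensional complex vector space. A $(\mathrm G_2)_{\mathbb C}$-structure on $W$ is a pair $(\varphi_{\mathbb C},\mathrm{vol}_{\mathbb C})\in\Lambda^3W^*\times\Lambda^7W^*$ (complex multilinear forms) such that there is a complex basis $E_1,\dots,E_7$ of $W$ (an adapted basis) with dual basis $E^1,\dots,E^7$, $\mathrm{vol}_{\mathbb C}=E^{1234567}$ and $\varphi_{\mathbb C}=E^{127}+E^{347}+E^{567}+E^{135}-E^{146}-E^{236}-E^{245}$. It induces a non-degenerate symmetric complex bilinear form $g_{\mathbb C}$ on $W$ by $g_{\mathbb C}(v,w)\,\mathrm{vol}_{\mathbb C}=\frac16(v\lrcorner\varphi_{\mathbb C})\wedge(w\lrcorner\varphi_{\mathbb C})\wedge\varphi_{\mathbb C}$, for which $g_{\mathbb C}(E_j,E_k)=\delta_{jk}$. The Hodge star $\star_{\varphi_{\mathbb C}}:\Lambda^kW^*\to\Lambda^{7-k}W^*$ is defined by $\psi\wedge\phi=g_{\mathbb C}(\star_{\varphi_{\mathbb C}}\psi,\phi)\,\mathrm{vol}_{\mathbb C}$ for all $\phi\in\Lambda^{7-k}W^*$. In an adapted basis, $\star_{\varphi_{\mathbb C}}\varphi_{\mathbb C}=E^{1234}+E^{1256}+E^{3456}-E^{2467}+E^{2357}+E^{1457}+E^{1367}$. On a complex Lie algebra $\mathfrak g$, $d$ is the exterior derivative on $\Lambda^*\mathfrak g^*$ determined by $(d\alpha)(X,Y)=-\alpha([X,Y])$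 for $\alpha\in\mathfrak g^*$. A cocalibrated $(\mathrm G_2)_{\mathbb C}$-structure on a seven-dimensional complex Lie algebra $\mathfrak g$ is a $(\mathrm G_2)_{\mathbb C}$-structure $(\varphi_{\mathbb C},\mathrm{vol}_{\mathbb C})$ on $\mathfrak g$ with $d\star_{\varphi_{\mathbb C}}\varphi_{\mathbb C}=0$. $\mathfrak{sp}(\mathfrak u,\omega)=\{f\in\mathfrak{gl}(\mathfrak u):\omega(f v,w)+\omega(v,f w)=0\ \forall v,w\in\mathfrak u\}$. ''Similar under $\mathrm{GL}(\mathfrak u)$'' means conjugate by an element of $\mathrm{GL}(\mathfrak u)$. *)

(* Defs.v *)
From HB Require Import structures.
From mathcomp Require Import all_boot all_order all_fingroup all_algebra.
From mathcomp Require Import reals complex.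

Set Implicit Arguments.
Unset Strict Implicit.
Unset Printing Implicit Defensive.

Import GRing.Theory.
Local Open Scope ring_scope.

Section Forms.
Variables (F : fieldType) (W : vectType F).

(* Carrier of k-forms: the elements of Λ^k W^* are the functions of this type
   satisfying is_altform. *)
Definition kform (k : nat) := ('I_k -> W) -> F.

Definition upd k (v : 'I_k -> W) (i : 'I_k) (x : W) : 'I_k -> W :=
  fun j => if j == i then x else v j.

Definition multilinear k (alpha : kform k) :=
  forall (v : 'I_k -> W) (i : 'I_k) (a : F) (x y : W),
    alpha (upd v i (a *: x + y)) = a * alpha (upd v i x) + alpha (upd v i y).

Definition alternating k (alpha : kform k) :=
  forall (v : 'I_k -> W) (i j : 'I_k), i != j -> v i = v j -> alpha v = 0.

Definition is_altform k (alpha : kform k) := multilinear alpha /\ alternating alpha.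

(* Normalised so that (e^1 ∧ ... ∧ e^k)(e_1, ..., e_k) = 1 for a basis e with
   dual basis e^1, ..., e^k. *)
Definition wedge k l (alpha : kform k) (beta : kform l) : kform (k + l) :=
  fun v => ((k`! * l`!)%:R)^-1 *
    \sum_(s : 'S_(k + l)) (-1) ^+ s *
      (alpha (fun i => v (s (lshift l i))) * beta (fun j => v (s (rshift k j)))).

(* The list x, v_0, ..., v_(k-1). *)
Definition vcons k (x : W) (v : 'I_k -> W) : 'I_k.+1 -> W :=
  fun i => oapp v x (unlift ord0 i).

Definition contract k (x : W) (alpha : kform k.+1) : kform k :=
  fun v => alpha (vcons x v).

(* The bilinear form induced by g on k-forms,
     (1/k!) g^(i_1 j_1) ... g^(i_k j_k) alpha_(i_1 ... i_k) beta_(j_1 ... j_k),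
   in components with respect to a basis b; the value does not depend on b.
   If e is g-orthonormal, then so are the e^(i_1) ∧ ... ∧ e^(i_k), i_1 < ... < i_k. *)
Definition inner_form (g : W -> W -> F) k (alpha beta : kform k) : F :=
  let b := vbasis {:W} in
  let G := \matrix_(i < \dim {:W}, j < \dim {:W}) g b`_i b`_j in
  (k`!%:R)^-1 *
  \sum_(f : {ffun 'I_k -> 'I_(\dim {:W})}) \sum_(h : {ffun 'I_k -> 'I_(\dim {:W})})
    (\prod_(a < k) invmx G (f a) (h a)) *
      (alpha (fun a => b`_(f a)) * beta (fun a => b`_(h a))).

Definition is_hodge_star (g : W -> W -> F) k l (vol : kform (k + l))
    (psi : kform k) (star_psi : kform l) :=
  is_altform star_psi /\
  forall phi : kform l, is_altform phi ->
    forall v, wedge psi phi v = inner_form g star_psi phi * vol v.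

(* Dual basis element E^i, numbered from i = 1 to i = 7. *)
Definition coframe (E : 7.-tuple W) (i : nat) : kform 1 :=
  fun v => coord E (inord i.-1) (v ord0).

(* E^(i_1) ∧ ... ∧ E^(i_k) for s = [:: i_1; ...; i_k]. *)
Fixpoint cowedge (E : 7.-tuple W) (s : seq nat) : kform (size s) :=
  match s with
  | [::] => fun _ => 1
  | i :: s' => wedge (coframe E i) (@cowedge E s')
  end.

Arguments cowedge E s : clear implicits.

Definition adapted_basis (phi : kform 3) (vol : kform 7) (E : 7.-tuple W) :=
  [/\ basis_of {:W} E,
      forall v : 'I_7 -> W, vol v = cowedge E [:: 1; 2; 3; 4; 5; 6; 7] v &
      forall v : 'I_3 -> W, phi v =
        cowedge E [:: 1; 2; 7] v + cowedge E [:: 3; 4; 7] v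
        + cowedge E [:: 5; 6; 7] v + cowedge E [:: 1; 3; 5] v
        - cowedge E [:: 1; 4; 6] v - cowedge E [:: 2; 3; 6] v
        - cowedge E [:: 2; 4; 5] v].

Definition G2C_structure (phi : kform 3) (vol : kform 7) :=
  exists E : 7.-tuple W, adapted_basis phi vol E.

Definition induced_metric (phi : kform 3) (vol : kform 7) (g : W -> W -> F) :=
  forall (x y : W) (v : 'I_7 -> W),
    g x y * vol v =
    6%:R^-1 * wedge (wedge (contract x phi) (contract y phi)) phi v.

Definition nondegenerate_on (g : W -> W -> F) (u : {vspace W}) :=
  forall x, x \in u -> (forall y, y \in u -> g x y = 0) -> x = 0.

End Forms.

Arguments cowedge {F W} E s _.

Section LieAlgebras.
Variables (F : fieldType) (L : vectType F) (br : {bilinear L -> L -> L}).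

Definition is_lie_bracket :=
  (forall x, br x x = 0) /\
  (forall x y z, br x (br y z) + br y (br z x) + br z (br x y) = 0).

Definition abelian_ideal (u : {vspace L}) :=
  (forall x y, y \in u -> br x y \in u) /\
  (forall x y, x \in u -> y \in u -> br x y = 0).

(* Chevalley-Eilenberg formula for the antiderivation extending
   (d alpha)(X, Y) = - alpha([X, Y]):
     d alpha (X_0, ..., X_k) = sum over i < j' of
       (-1)^(i + j') alpha([X_i, X_j'], X_0, ..., X_k without X_i and X_j').
   Since i <= j, the index lift i j is j' = j + 1, and the indices lift i (lift j c)
   are those different from i and j', in increasing order. *)
Definition ext_d m (alpha : kform L m.+1) : kform L m.+2 :=
  fun X => \sum_(i < m.+2) \sum_(j < m.+1 | (i <= j)%N)
    (-1) ^+ (i + lift i j) *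
      alpha (vcons (br (X i) (X (lift i j))) (fun c : 'I_m => X (lift i (lift j c)))).

(* The last component is d(⋆phi) = 0; g and ⋆phi are determined by (phi, vol). *)
Definition cocalibrated_G2C_structure (phi : kform L 3) (vol : kform L 7)
    (g : {biscalar L}) (star_phi : kform L 4) :=
  [/\ G2C_structure phi vol,
      induced_metric phi vol g,
      is_hodge_star (k := 3) (l := 4) g vol phi star_phi &
      forall X, ext_d star_phi X = 0].

(* When u is an ideal, [e, x] lies in u for x in u and vsproj u only changes its
   type. *)
Definition ad_on (e : L) (u : {vspace L}) : 'End(subvs_of u) :=
  linfun (fun x : subvs_of u => vsproj u (br e (vsval x))).

End LieAlgebras.

Section Endomorphisms.
Variables (F : fieldType) (U : vectType F).

Definition nondegenerate_2form (omega : {biscalar U}) :=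
  (forall x, omega x x = 0) /\ nondegenerate_on omega {:U}.

Definition in_sp (omega : {biscalar U}) (f : 'End(U)) :=
  forall v w, omega (f v) w + omega v (f w) = 0.

Definition similar_end (A B : 'End(U)) :=
  exists2 h : 'End(U), lker h == 0%VS & A = (h \o B \o h^-1)%VF.

Definition jordan_block n (a : F) : 'M[F]_n :=
  \matrix_(i, j) (a *+ (i == j :> nat) + (i.+1 == j)%:R).

(* A Jordan matrix is encoded by the list of the pairs (size, eigenvalue) of its
   diagonal blocks. *)
Definition block_size (s : seq (nat * F)) (i : 'I_(size s)) : nat :=
  (tnth (in_tuple s) i).1.

Definition jordan_mx (s : seq (nat * F)) : 'M[F]_(\sum_i block_size (s := s) i) :=
  \mxdiag_i jordan_block (block_size i) (tnth (in_tuple s) i).2.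

Definition jordan_normal_form (A : 'End(U)) (s : seq (nat * F)) :=
  all (fun b => 0 < b.1)%N s /\
  exists2 X : (\sum_i block_size (s := s) i).-tuple U,
    basis_of {:U} X &
    forall j : 'I_(\sum_i block_size (s := s) i), A X`_j = \sum_i jordan_mx s i j *: X`_i.

Definition nb_blocks (s : seq (nat * F)) (m : nat) (a : F) : nat :=
  count_mem (m, a) s.

End Endomorphisms.

(* Main.v *)
Require Import Defs.
From HB Require Import structures.
From mathcomp Require Import all_boot all_order all_fingroup all_algebra.
From mathcomp Require Import reals complex.
From mathcomp Require Import boolp ring zify.

Set Implicit Arguments.
Unset Strict Implicit.
Unset Printing Implicit Defensive.

Import GRing.Theory Num.Theory.
Local Open Scope ring_scope.

(** Write A for ad(e7) restricted to u. Each of the three conditions turns out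
to say that A preserves some non-degenerate two-form on u, where no particular
two-form is prescribed ([preserves_sympl]).

For (b) this holds because all non-degenerate two-forms on u have the same Gram
matrix in suitable bases and are thus related by GL(u) ([sympl_isometry],
[similar_sp_iff]).

For (a), let c be the functional with kernel u and c(e7) = 1. Since u is
Abelian, d(star phi) = - c ∧ (A acting on star phi as a derivation), so that
star phi is closed if and only if A annihilates its restriction to u
([closed_iff_lie_der]). Let n be a normal vector of u and let w be the
restriction of n ⌟ phi to u. The G2 identity

  (1/2) (n ⌟ phi)^2 = g(n, n) star phi - n^♭ ∧ (n ⌟ star phi)

shows that star phi restricts to a multiple of w ∧ w ([phi_square]), and the
identity |n × x|^2 = |n|^2 |x|^2 - g(n, x)^2 shows that w is non-degenerate
([phi_cross_norm]). Now A annihilates w ∧ w if and only if (A w) ∧ w = 0, and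
in dimension six wedging with w is injective on two-forms ([sympl_wedge_inj]);
so A preserves w. Conversely, a symplectic basis of a preserved two-form,
followed by e7, is taken as an adapted basis. Working with a normal vector
avoids any appeal to the transitivity of the group G2 on such vectors.

The identities for phi, the value of the metric and that of the Hodge star are
multilinear, so it suffices to verify them on basis vectors. There a form is an
integer combination of products of dual basis vectors, and its values are
determinants of matrices of Kronecker deltas, which can be computed.

For (c), let M be the Jordan matrix of A and let O be the Gram matrix of a
preserved two-form in a Jordan basis, so that M^T O = - O M. Then (M - l)^k and
(M + l)^k have the same rank for all k, and these ranks determine the numbers
of blocks ([nb_blocks_rank]). Moreover (M^T)^(2j) O is skew, so M^(2j) has even
rank ([skew_rank_even]), and the number of blocks of size 2j + 1 for the
eigenvalue 0 is
  rank M^(2j) - 2 rank M^(2j+1) + rank M^(2j+2).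
Conversely, if the blocks satisfy (c), there is an involution which matches
every block with one of the same size and opposite eigenvalue and fixes no
block of odd size ([block_matching]); pairing position p of a block with
position m - 1 - p of its match, with alternating signs, gives a preserved
two-form ([blocks_preserve_sympl]). The existence of the Jordan form itself is
proved by Filippov's induction ([jordan_chains]). *)

(** * Alternating forms and determinants *)

Section Multilinear.
Variables (F : numFieldType) (W : vectType F).

Lemma vcons0 k (x : W) (v : 'I_k -> W) : vcons x v ord0 = x.
Proof. by rewrite /vcons unlift_none. Qed.

Lemma vconsS k (x : W) (v : 'I_k -> W) i : vcons x v (lift ord0 i) = v i.
Proof. by rewrite /vcons liftK. Qed.

Lemma vcons_eta k (v : 'I_k.+1 -> W) :
  v = vcons (v ord0) (fun i => v (lift ord0 i)).
Proof.
by apply: funext => i; case: (unliftP ord0 i) => [j|] ->; rewrite ?vconsS ?vcons0.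
Qed.

Lemma upd_vcons0 k (x y : W) (v : 'I_k -> W) :
  upd (vcons x v) ord0 y = vcons y v.
Proof.
apply: funext => i; case: (unliftP ord0 i) => [j|] ->; rewrite /upd.
  by rewrite !vconsS.
by rewrite eqxx vcons0.
Qed.

Lemma upd_vconsS k (x y : W) (v : 'I_k -> W) i :
  upd (vcons x v) (lift ord0 i) y = vcons x (upd v i y).
Proof.
apply: funext => j; case: (unliftP ord0 j) => [l|] ->; rewrite /upd.
  by rewrite !vconsS (inj_eq lift_inj).
by rewrite !vcons0.
Qed.

Lemma multilinear_contract k (al : kform W k.+1) x :
  multilinear al -> multilinear (contract x al).
Proof. by move=> H v i a y z; rewrite /contract -!upd_vconsS H. Qed.

Lemma contractDZ k (al : kform W k.+1) a x y v : multilinear al ->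
  contract (a *: x + y) al v = a * contract x al v + contract y al v.
Proof.
move=> H; rewrite /contract -(upd_vcons0 0 (_ + _)) H.
by rewrite !upd_vcons0.
Qed.

Lemma contract0 k (al : kform W k.+1) v : multilinear al -> contract 0 al v = 0.
Proof.
move=> H; have := contractDZ 1 0 0 v H; rewrite scale1r addr0 mul1r.
by move/eqP; rewrite -subr_eq subrr => /eqP <-.
Qed.

Lemma contract_sum k (al : kform W k.+1) (I : finType) (c : I -> F) (b : I -> W) v :
  multilinear al ->
  contract (\sum_j c j *: b j) al v = \sum_j c j * contract (b j) al v.
Proof.
move=> H; elim/big_rec2: _ => [|j x y _ <-]; first exact: contract0.
by rewrite contractDZ.
Qed.

(** By induction on the number of slots: slot 0 is expanded through [contract], and
a function on 'I_k.+1 is a value at 0 together with a function on 'I_k. *)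
Lemma multilinear_expand k (al : kform W k) (I : finType) (b : I -> W)
    (c : 'I_k -> I -> F) : multilinear al ->
  al (fun i => \sum_j c i j *: b j) =
  \sum_(f : {ffun 'I_k -> I}) (\prod_i c i (f i)) * al (fun i => b (f i)).
Proof.
elim: k al c => [|k IHk] al c H.
  have f0 : {ffun 'I_0 -> I} by apply: finfun; case.
  rewrite (bigD1 f0) //= [X in _ + X]big1 => [|f /negP h]; last first.
    by case: h; apply/eqP/ffunP; case.
  rewrite addr0 big_ord0 mul1r; congr al.
  by apply: funext => -[].
pose cons_f (p : I * {ffun 'I_k -> I}) : {ffun 'I_k.+1 -> I} :=
  [ffun i => oapp p.2 p.1 (unlift ord0 i)].
pose uncons_f (f : {ffun 'I_k.+1 -> I}) : I * {ffun 'I_k -> I} :=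
  (f ord0, [ffun i => f (lift ord0 i)]).
have K : {on [pred i | true], bijective cons_f}.
  exists uncons_f => [[j f] _|f _].
    congr pair; rewrite /= ?ffunE ?unlift_none //.
    by apply/ffunP => i; rewrite !ffunE liftK.
  apply/ffunP => i; rewrite ffunE /=.
  by case: (unliftP ord0 i) => [l|] -> //=; rewrite ffunE.
rewrite (reindex cons_f K) /= -(pair_bigA _ (fun j f =>
  (\prod_i c i (cons_f (j, f) i)) * al (fun i => b (cons_f (j, f) i)))) /=.
rewrite [X in al X]vcons_eta -/(contract _ _ _) contract_sum //.
apply: eq_bigr => j _.
rewrite (IHk _ (fun i => c (lift ord0 i))); last exact: multilinear_contract.
rewrite big_distrr /=; apply: eq_bigr => f _.
rewrite mulrA big_ord_recl ffunE unlift_none /=; congr (_ * _ * _).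
  by apply: eq_bigr => i _; rewrite ffunE liftK.
rewrite /contract; congr al; apply: funext => i; rewrite ffunE.
by case: (unliftP ord0 i) => [l|] ->; rewrite ?vconsS ?vcons0 //= ffunE.
Qed.

(** The value with v i + v j in both of the slots i and j is zero; expand it. *)
Lemma altform_swap k (al : kform W k) v i j : is_altform al -> i != j ->
  al (fun l => v (tperm i j l)) = - al v.
Proof.
move=> [ml alt] ne.
pose w x y := upd (upd v i x) j y.
have wE x y : w x y = upd (upd v j y) i x.
  apply: funext => l; rewrite /w /upd; case: (l =P i) => [->|//].
  by rewrite (negPf ne).
have D1 x x' y : al (w (x + x') y) = al (w x y) + al (w x' y).
  by rewrite !wE -[x]scale1r ml scale1r mul1r.
have D2 x y y' : al (w x (y + y')) = al (w x y) + al (w x y').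
  by rewrite /w -[y]scale1r ml scale1r mul1r.
have D0 x : al (w x x) = 0.
  by apply: (alt _ i j) => //; rewrite /w /upd eqxx (negPf ne) eqxx.
have := D0 (v i + v j); rewrite D1 !D2 !D0 add0r addr0.
have -> : w (v i) (v j) = v.
  by apply: funext => l; rewrite /w /upd; case: eqP => [->|_] //; case: eqP => [->|_].
have -> : w (v j) (v i) = (fun l => v (tperm i j l)).
  apply: funext => l; rewrite /w /upd.
  case: tpermP => [->|->|/eqP h1 /eqP h2]; rewrite ?eqxx ?(negPf ne) //.
  by rewrite (negPf h1) (negPf h2).
by move/eqP; rewrite addrC addr_eq0 => /eqP.
Qed.

Lemma altform_perm k (al : kform W k) v (s : 'S_k) : is_altform al ->
  al (fun l => v (s l)) = (-1) ^+ s * al v.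
Proof.
move=> H; case: (prod_tpermP s) => ts -> {s}.
elim: ts v => [|t ts IH] v /=.
  move=> _; rewrite big_nil odd_perm1 mul1r; congr al.
  by apply: funext => i; rewrite perm1.
move=> /andP [ne /IH {}IH]; rewrite big_cons odd_mul_tperm ne.
under [X in al X]funext do rewrite permM.
pose v' i := v ((\prod_(t <- ts) tperm t.1 t.2)%g i).
rewrite -[LHS]/(al (fun l => v' (tperm t.1 t.2 l))) altform_swap // /v' IH.
by rewrite addTb signrN mulNr.
Qed.

Variable n : nat.
Variable E : n.-tuple W.
Hypothesis bE : basis_of {:W} E.

Lemma coord_expand x : x = \sum_i coord E i x *: E`_i.
Proof. exact: coord_basis bE (memvf x). Qed.

Lemma coordE_delta (i j : 'I_n) : coord E i E`_j = (j == i)%:R.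
Proof. by rewrite coord_free ?(basis_free bE). Qed.

(** The form E^(s 0) ∧ ... ∧ E^(s (k - 1)). The index tuple s may be any function,
so that no sorting of indices is ever required. *)
Definition coframe_form k (s : 'I_k -> 'I_n) : kform W k :=
  fun v => \det (\matrix_(i, j) coord E (s j) (v i)).

Lemma coframe_form_alt k (s : 'I_k -> 'I_n) : is_altform (coframe_form s).
Proof.
split=> [v i a x y|v i j ne e]; last first.
  by apply: (determinant_alternate ne) => l; rewrite !mxE e.
rewrite -[X in _ = _ + X]mul1r.
apply: (@determinant_multilinear _ _ _ _ _ i).
- by apply/rowP=> l; rewrite !mxE /upd eqxx linearP /= mul1r.
- by apply/matrixP=> l l'; rewrite !mxE /upd eq_sym (negPf (neq_lift _ _)).
- by apply/matrixP=> l l'; rewrite !mxE /upd eq_sym (negPf (neq_lift _ _)).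
Qed.

Lemma coframe_form_basis k (s t : 'I_k -> 'I_n) :
  coframe_form s (fun i => E`_(t i)) = \det (\matrix_(i, j) (t i == s j)%:R).
Proof.
by congr (\det _); apply/matrixP=> i j; rewrite !mxE coordE_delta.
Qed.

Lemma coframe_form_basis_sym k (s t : 'I_k -> 'I_n) :
  coframe_form s (fun i => E`_(t i)) = coframe_form t (fun i => E`_(s i)).
Proof.
rewrite !coframe_form_basis -det_tr; congr (\det _).
by apply/matrixP=> i j; rewrite !mxE eq_sym.
Qed.

(** Multiplicativity of the determinant. *)
Lemma coframe_form_top (s : 'I_n -> 'I_n) v :
  coframe_form s v = coframe_form s (fun i => E`_i) * coframe_form id v.
Proof.
rewrite coframe_form_basis mulrC -det_mulmx; congr (\det _).
apply/matrixP=> i j; rewrite !mxE (bigD1 (s j)) //= big1 => [|l ne].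
  by rewrite !mxE eqxx mulr1 addr0.
by rewrite !mxE (negPf ne) mulr0.
Qed.

(** Expand the arguments in the basis and antisymmetrise. The sum runs over all index
tuples instead of the increasing ones, which is what the factor k! compensates. *)
Lemma altform_expand k (al : kform W k) v : is_altform al ->
  al v = (k`!%:R)^-1 *
    \sum_(f : {ffun 'I_k -> 'I_n}) al (fun i => E`_(f i)) * coframe_form f v.
Proof.
move=> H.
have fn0 : (k`!%:R : F) != 0 by rewrite pnatr_eq0 -lt0n fact_gt0.
apply: (mulfI fn0); rewrite mulrA divff // mul1r.
rewrite /coframe_form; under eq_bigr do rewrite -det_tr /determinant big_distrr /=.
rewrite exchange_big /=.
rewrite -card_Sn -sumr_const big_distrl /=; apply: eq_big => [s|s _].
  by rewrite inE.
rewrite mul1r.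
rewrite {1}(_ : v = fun i => \sum_j coord E j (v i) *: E`_j); last first.
  by apply: funext => i; apply: coord_expand.
rewrite (multilinear_expand _ _ H.1).
have Ks : {on [pred i | true], bijective (fun f : {ffun 'I_k -> 'I_n} =>
    [ffun i => f (s^-1 i)%g])}.
  exists (fun f : {ffun 'I_k -> 'I_n} => [ffun i => f (s i)]) => f _;
  by apply/ffunP => i; rewrite !ffunE ?permK ?permKV.
rewrite (reindex _ Ks) /=; apply: eq_bigr => f _.
have -> : al (fun i => E`_([ffun i => f (s^-1 i)%g] i)) =
    (-1) ^+ s * al (fun j => E`_(f j)).
  rewrite -odd_permV -(altform_perm (fun j => E`_(f j))) //; congr al.
  by apply: funext => i; rewrite ffunE.
rewrite [LHS]mulrC -mulrA [RHS]mulrCA; congr (_ * (_ * _)).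
rewrite (reindex_inj (@perm_inj _ s)) /=; apply: eq_bigr => i _.
by rewrite ffunE permK !mxE.
Qed.


Lemma wedge_suml (k l : nat) (I : Type) (r : seq I) (c : I -> F) (al : I -> kform W k)
    (be : kform W l) v :
  wedge (fun v => \sum_(i <- r) c i * al i v) be v =
  \sum_(i <- r) c i * wedge (al i) be v.
Proof.
rewrite /wedge; under eq_bigr do rewrite big_distrl big_distrr /=.
rewrite exchange_big /= big_distrr /=; apply: eq_bigr => i _.
rewrite mulrCA; congr (_ * _); rewrite big_distrr; apply: eq_bigr => s _ /=.
by rewrite -mulrA mulrCA.
Qed.

Lemma wedge_sumr (k l : nat) (I : Type) (r : seq I) (c : I -> F) (be : I -> kform W l)
    (al : kform W k) v :
  wedge al (fun v => \sum_(i <- r) c i * be i v) v =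
  \sum_(i <- r) c i * wedge al (be i) v.
Proof.
rewrite /wedge; under eq_bigr do rewrite 2!big_distrr /=.
rewrite exchange_big /= big_distrr /=; apply: eq_bigr => i _.
rewrite mulrCA; congr (_ * _); rewrite big_distrr; apply: eq_bigr => s _ /=.
rewrite [RHS]mulrCA; congr (_ * _).
by rewrite mulrCA.
Qed.

Section BlockPerm.
Variables (k l : nat) (t : 'S_k) (r : 'S_l).

Definition block_fun (i : 'I_(k + l)) : 'I_(k + l) :=
  match split i with inl a => lshift l (t a) | inr b => rshift k (r b) end.

Lemma block_fun_inj : injective block_fun.
Proof.
move=> i j; rewrite /block_fun; case: (split_ordP i) => a ->; case: (split_ordP j) => b ->.
- by move/lshift_inj/perm_inj ->.
- by move/eqP; rewrite eq_lrshift.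
- by move/eqP; rewrite eq_rlshift.
- by move/rshift_inj/perm_inj ->.
Qed.

Definition block_perm : 'S_(k + l) := perm block_fun_inj.

Lemma block_permL a : block_perm (lshift l a) = lshift l (t a).
Proof. by rewrite permE /block_fun (unsplitK (inl a)). Qed.

Lemma block_permR a : block_perm (rshift k a) = rshift k (r a).
Proof. by rewrite permE /block_fun (unsplitK (inr a)). Qed.

Lemma sign_block_perm : (-1) ^+ block_perm = (-1) ^+ t * (-1) ^+ r :> F.
Proof.
rewrite -!det_perm -(det_ublock _ 0); congr (\det _).
apply/matrixP=> i j; rewrite !mxE.
case: (split_ordP i) => a ->; rewrite ?block_permL ?block_permR !mxE;
case: (split_ordP j) => b ->; rewrite ?mxE ?eq_lshift ?eq_rshift ?eq_lrshift ?eq_rlshift //.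
Qed.
End BlockPerm.

(** Expanding both determinants gives a sum over pairs (p, q) of permutations of the
two groups of indices. For each pair, the sum over the permutations in the
definition of [wedge] is the whole determinant with its columns permuted by
[block_perm p q]; the k! l! pairs cancel the normalisation of [wedge]. *)
Lemma wedge_coframe_form k l (s : 'I_k -> 'I_n) (t : 'I_l -> 'I_n) v :
  wedge (coframe_form s) (coframe_form t) v =
  coframe_form (fun i => match split i with inl a => s a | inr b => t b end) v.
Proof.
set st := (fun i : 'I_(k + l) => _).
rewrite /wedge.
have fn0 : ((k`! * l`!)%:R : F) != 0 by rewrite pnatr_eq0 -lt0n muln_gt0 !fact_gt0.
apply: (mulfI fn0); rewrite mulrA divff // mul1r.
transitivity (\sum_(p : 'S_k) \sum_(q : 'S_l) \sum_(x : 'S_(k + l))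
   (-1) ^+ x * ((-1) ^+ block_perm p q *
      \prod_i coord E (st (block_perm p q i)) (v (x i)))).
  rewrite [RHS](eq_bigr _ (fun p _ => exchange_big _ _ _ _ _ _)) /= [RHS]exchange_big /=.
  apply: eq_bigr => x _.
  rewrite /coframe_form /determinant !big_distrl /= big_distrr; apply: eq_bigr => p _ /=.
  rewrite !big_distrr /=; apply: eq_bigr => q _.
  rewrite sign_block_perm big_split_ord /=.
  rewrite [X in _ = _ * (_ * (X * _))](eq_bigr (fun i =>
    (\matrix_(i, j) coord E (s j) (v (x (lshift l i)))) i (p i))); last first.
    by move=> i _; rewrite mxE block_permL /st (unsplitK (inl (p i))).
  rewrite [X in _ = _ * (_ * (_ * X))](eq_bigr (fun i =>
    (\matrix_(i, j) coord E (t j) (v (x (rshift k i)))) i (q i))); last first.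
    by move=> i _; rewrite mxE block_permR /st (unsplitK (inr (q i))).
  by rewrite -!mulrA; do 2!congr (_ * _); rewrite mulrCA.
transitivity (\sum_(p : 'S_k) \sum_(q : 'S_l) coframe_form st v).
  apply: eq_bigr => p _; apply: eq_bigr => q _.
  set b := block_perm p q.
  pose M := (\matrix_(i, j) coord E (st j) (v i))^T.
  have := det_mulmx (perm_mx b) M; rewrite -row_permE det_perm det_tr -/(coframe_form _ _).
  rewrite {1}/determinant => h.
  transitivity ((-1) ^+ b * ((-1) ^+ b * coframe_form st v)); last first.
    by rewrite mulrA -expr2 sqrr_sign mul1r.
  rewrite -h big_distrr; apply: eq_bigr => x _ /=; rewrite mulrCA.
  by do 2!congr (_ * _); apply: eq_bigr => i _; rewrite !mxE.
rewrite !sumr_const -mulrnA mulr_natl.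
rewrite (_ : #|_| = l`!); last by rewrite -[RHS]card_Sn; apply: eq_card => x; rewrite inE.
rewrite (_ : #|_| = k`!); last by rewrite -[RHS]card_Sn; apply: eq_card => x; rewrite inE.
by rewrite mulnC.
Qed.

End Multilinear.

(** * Forms with integer coefficients *)

Definition omit (r : nat) (t : seq nat) := take r t ++ drop r.+1 t.

(** The determinant of the matrix of Kronecker deltas between the entries of s and
those of t, by Laplace expansion along the first row; being a recursion on
sequences, it can be evaluated. *)
Fixpoint delta_det (s t : seq nat) : int :=
  if s is a :: s' then
    foldr (fun r acc => if a == nth 0%N t r
                        then (-1) ^+ r * delta_det s' (omit r t) + acc else acc)
          0 (iota 0 (size t))
  else 1.

Lemma nth_omit r t i : (r < size t)%N -> nth 0%N (omit r t) i = nth 0%N t (bump r i).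
Proof.
move=> lt_r; rewrite /omit nth_cat size_take lt_r /bump.
case: (ltnP i r) => h; first by rewrite nth_take.
by rewrite nth_drop; congr nth; lia.
Qed.

Lemma size_omit r t : (r < size t)%N -> size (omit r t) = (size t).-1.
Proof. by move=> h; rewrite size_cat size_take size_drop h; lia. Qed.

Lemma foldr_if_sum (R : nmodType) (I : Type) (P : pred I) (f : I -> R) l :
  foldr (fun r acc => if P r then f r + acc else acc) 0 l = \sum_(r <- l | P r) f r.
Proof. by elim: l => [|a l IH] /=; rewrite ?big_nil // big_cons IH. Qed.

Lemma delta_detP (R : comNzRingType) k (s t : seq nat) : size s = k -> size t = k ->
  \det (\matrix_(i < k, j < k) (nth 0%N s i == nth 0%N t j)%:R) =
  (delta_det s t)%:~R :> R.
Proof.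
elim: k s t => [|k IH] s t; first by case: s => // _ _; rewrite det_mx00.
case: s => // a s [hs] ht.
rewrite (expand_det_row _ ord0) /= foldr_if_sum ht.
rewrite -[iota 0 k.+1]/(index_iota 0 k.+1) big_mkord rmorph_sum /= [RHS]big_mkcond /=.
apply: eq_bigr => j _; rewrite mxE /=; case: ifP => _; last by rewrite mul0r.
rewrite mul1r /cofactor add0n intrM rmorphXn rmorphN1 -IH //; last first.
  by rewrite size_omit ht.
congr (_ * \det _); apply/matrixP=> i l; rewrite !mxE /= nth_omit ?ht //.
Qed.

(** The term (c, [:: i; j; ...]) stands for c times E^i ∧ E^j ∧ ... with basis indices
counted from 0, whereas [cowedge] counts them from 1. *)
Definition formal := seq (int * seq nat).

Definition wf_formal (k : nat) (p : formal) :=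
  all (fun m => (size m.2 == k) && all (fun a => a < 7)%N m.2) p.

Definition formal_wedge (p q : formal) : formal :=
  [seq (a.1 * b.1, a.2 ++ b.2) | a <- p, b <- q].

Lemma wf_formal_wedge k l p q :
  wf_formal k p -> wf_formal l q -> wf_formal (k + l) (formal_wedge p q).
Proof.
move=> wp wq; apply/allP => m /allpairsP [[a b] /= [ha hb ->]] /=.
rewrite size_cat all_cat.
have /andP [/eqP -> ->] := allP wp _ ha; have /andP [/eqP -> ->] := allP wq _ hb.
by rewrite eqxx.
Qed.

Definition formal_contract (i : nat) (p : formal) : formal :=
  flatten [seq [seq ((-1) ^+ r * m.1, omit r m.2) |
             r <- iota 0 (size m.2) & nth 0%N m.2 r == i] | m <- p].

Definition formal_val (p : formal) (t : seq nat) : int :=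
  foldr (fun m acc => m.1 * delta_det t m.2 + acc) 0 p.

Definition formal_phi : formal :=
  [:: (1, [:: 0; 1; 6]%N); (1, [:: 2; 3; 6]%N); (1, [:: 4; 5; 6]%N); (1, [:: 0; 2; 4]%N);
      (-1, [:: 0; 3; 5]%N); (-1, [:: 1; 2; 5]%N); (-1, [:: 1; 3; 4]%N)].

(** The coefficient of the volume form in phi ∧ E^t. For an orthonormal basis this is
the value of the Hodge dual of phi on the basis vectors listed in t. *)
Definition star_coef (t : seq nat) : int :=
  formal_val (formal_wedge formal_phi [:: (1, t)]) (iota 0 7).

Section Formal.
Variables (F : numFieldType) (W : vectType F) (E : 7.-tuple W).
Hypothesis bE : basis_of {:W} E.

Definition nat_form k (s : seq nat) : kform W k :=
  coframe_form E (fun i : 'I_k => inord (nth 0%N s i) : 'I_7).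
Arguments nat_form k s _ : clear implicits.

Lemma nat_form_alt k s : is_altform (nat_form k s).
Proof. exact: coframe_form_alt. Qed.

Definition eval_formal k (p : formal) : kform W k :=
  fun v => \sum_(m <- p) m.1%:~R * nat_form k m.2 v.
Arguments eval_formal k p _ : clear implicits.

Lemma eval_formal_alt k p : is_altform (eval_formal k p).
Proof.
split=> [v i a x y|v i j ne e]; rewrite /eval_formal; last first.
  by apply: big1 => m _; rewrite ((nat_form_alt _ _).2 _ _ _ ne e) mulr0.
rewrite big_distrr /= -big_split; apply: eq_bigr => m _ /=.
by rewrite (nat_form_alt _ _).1 mulrDr mulrCA.
Qed.

Lemma eval_formal_val k p (t : seq nat) :
  wf_formal k p -> size t = k -> all (fun a => a < 7)%N t ->
  eval_formal k p (fun i => E`_(nth 0%N t i)) = (formal_val p t)%:~R.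
Proof.
move=> wf st lt; rewrite /eval_formal /formal_val.
have -> : foldr (fun m acc => m.1 * delta_det t m.2 + acc) 0 p =
   \sum_(m <- p) m.1 * delta_det t m.2.
  by rewrite -(foldr_if_sum xpredT).
rewrite rmorph_sum /=; apply: eq_big_seq => m /(allP wf) /andP [/eqP sm lm].
rewrite intrM -(delta_detP _ st sm) /=; congr (_ * _).
rewrite /nat_form (_ : (fun i : 'I_k => E`_(nth 0%N t i)) =
  fun i : 'I_k => E`_(inord (nth 0%N t i) : 'I_7)); last first.
  apply: funext => i; rewrite inordK //; apply: (allP lt).
  by rewrite mem_nth ?st.
rewrite coframe_form_basis //; congr (\det _); apply/matrixP=> i j; rewrite !mxE.
congr (_%:R); rewrite -val_eqE /= !inordK //.
  by apply: (allP lm); rewrite mem_nth ?sm.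
by apply: (allP lt); rewrite mem_nth ?st.
Qed.

Lemma eval_formal_wedge k l p q v : wf_formal k p ->
  wedge (eval_formal k p) (eval_formal l q) v = eval_formal (k + l) (formal_wedge p q) v.
Proof.
move=> wf; rewrite {1}/eval_formal wedge_suml /eval_formal big_allpairs_dep /=.
apply: eq_big_seq => m /(allP wf) /andP [/eqP sm _].
rewrite wedge_sumr big_distrr /=; apply: eq_bigr => m' _.
rewrite mulrA intrM; congr (_ * _); rewrite wedge_coframe_form; congr coframe_form.
apply: funext => i; rewrite nth_cat sm; case: splitP => j -> //.
by rewrite addKn.
Qed.

Lemma eval_formal_contract k p i v : (i < 7)%N -> wf_formal k.+1 p ->
  contract E`_i (eval_formal k.+1 p) v = eval_formal k (formal_contract i p) v.
Proof.
move=> li wf; rewrite /contract /eval_formal /formal_contract big_flatten big_map /=.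
apply: eq_big_seq => m /(allP wf) /andP [/eqP sm lm].
rewrite big_map big_filter sm -[iota 0 k.+1]/(index_iota 0 k.+1) big_mkord.
rewrite /nat_form /coframe_form (expand_det_row _ ord0) big_distrr /= [RHS]big_mkcond /=.
apply: eq_bigr => j _; rewrite mxE vcons0.
have -> : E`_i = E`_(inord i : 'I_7) by rewrite inordK.
rewrite coordE_delta // -val_eqE /= inordK //.
rewrite inordK; last by apply: (allP lm); rewrite mem_nth ?sm.
rewrite eq_sym; case: ifP => _; last by rewrite mul0r mulr0.
rewrite mul1r /cofactor add0n intrM rmorphXn rmorphN1 -!mulrA mulrCA; do 2!congr (_ * _).
congr (\det _); apply/matrixP=> a b; rewrite !mxE /= vconsS nth_omit ?sm //.
Qed.

Lemma eval_formal_top p v : wf_formal 7 p ->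
  eval_formal 7 p v = (formal_val p (iota 0 7))%:~R * nat_form 7 (iota 0 7) v.
Proof.
have e (i : 'I_7) : nth 0%N [:: 0; 1; 2; 3; 4; 5; 6]%N i = i.
  by rewrite -[[:: _ & _]]/(iota 0 7) nth_iota.
move=> wf; rewrite -(eval_formal_val wf) // /eval_formal big_distrl; apply: eq_bigr => m _ /=.
rewrite -mulrA; congr (_ * _); rewrite {1}/nat_form coframe_form_top //; congr (_ * _).
  by congr coframe_form; apply: funext => i; rewrite e.
rewrite /nat_form; congr (coframe_form _ _ _); apply: funext => i.
by rewrite e inord_val.
Qed.

Lemma cowedge_nat_form (s : seq nat) v :
  cowedge E s v = nat_form (size s) (map predn s) v.
Proof.
elim: s v => [|i s IH] v /=; first by rewrite /nat_form /coframe_form det_mx00.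
have -> : cowedge E s = nat_form (size s) (map predn s) by apply: funext.
have -> : coframe E i = nat_form 1 [:: i.-1].
  by apply: funext => w; rewrite /nat_form /coframe_form det_mx11 mxE.
rewrite -[LHS]/(wedge (nat_form 1 _) (nat_form (size s) _) v) /nat_form wedge_coframe_form.
congr coframe_form; apply: funext => j; case: splitP => a ha.
  by rewrite ha; case: a {ha} => -[].
by rewrite ha.
Qed.

Section G2.
Variables (phi : kform W 3) (vol : kform W 7).
Hypothesis ad : adapted_basis phi vol E.

Lemma adapted_phi : phi = eval_formal 3 formal_phi.
Proof.
case: ad => _ _ h; apply: funext => v; rewrite h !cowedge_nat_form.
rewrite /eval_formal !big_cons big_nil /=.
by rewrite !mulrN1z !mulN1r !mul1r addr0 !addrA.
Qed.

Lemma adapted_vol : vol = nat_form 7 (iota 0 7).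
Proof. by case: ad => _ h _; apply: funext => v; rewrite h !cowedge_nat_form. Qed.

Lemma adapted_volE : vol (fun i => E`_i) = 1.
Proof.
have fv : formal_val [:: (1, iota 0 7)] (iota 0 7) = 1 by vm_compute.
have h := @eval_formal_val 7 [:: (1, iota 0 7)] (iota 0 7) isT erefl isT.
rewrite fv /eval_formal big_seq1 mul1r in h; rewrite adapted_vol -[RHS]h.
congr (nat_form _ _ _); apply: funext => i.
by rewrite nth_iota.
Qed.

(** The 49 coefficients behind g(E_i, E_j) = delta_ij, together with the side
conditions under which they may be used. *)
Lemma metric_check :
  all (fun i => all (fun j =>
    let q := formal_wedge (formal_contract i formal_phi) (formal_contract j formal_phi) in
    let p := formal_wedge q formal_phi in
    [&& wf_formal 2 (formal_contract i formal_phi), wf_formal 4 q, wf_formal 7 p &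
       formal_val p (iota 0 7) == if i == j then 6 else 0])
    (iota 0 7)) (iota 0 7).
Proof. by vm_compute. Qed.

End G2.
End Formal.
Arguments nat_form {F W} E k s _.
Arguments eval_formal {F W} E k p _.

(** * Metric and Hodge star in an adapted basis *)

Section InnerForm.
Variables (F : numFieldType) (W : vectType F) (n : nat) (E : n.-tuple W).
Hypothesis bE : basis_of {:W} E.

Definition dot x y := \sum_i coord E i x * coord E i y.

(** If P contains the coordinates of the orthonormal vectors E_a in the basis b, then
the Gram matrix of b has the inverse P^T P, and contracting with the latter
evaluates both forms on the vectors E_a. *)
Lemma inner_form_orthonormal (g : W -> W -> F) k (al be : kform W k) :
  (forall x y, g x y = dot x y) -> multilinear al -> multilinear be ->
  inner_form g al be =
  (k`!%:R)^-1 * \sum_(f : {ffun 'I_k -> 'I_n})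
     al (fun a => E`_(f a)) * be (fun a => E`_(f a)).
Proof.
move=> gE ml ml'; rewrite /inner_form; congr (_ * _).
set b := vbasis {:W}; set G := \matrix_(i, j) _.
have bb : basis_of {:W} b by apply: vbasisP.
pose P := \matrix_(a < n, i < \dim {:W}) coord b i E`_a.
pose Q := \matrix_(i < \dim {:W}, a < n) coord E a b`_i.
have PQ : P *m Q = 1%:M.
  apply/matrixP=> a c; rewrite !mxE; under eq_bigr do rewrite !mxE.
  rewrite -(coordE_delta bE) {2}(coord_expand bb E`_a) linear_sum.
  by apply: eq_bigr => i _; rewrite linearZ.
have QP : Q *m P = 1%:M.
  apply/matrixP=> i j; rewrite !mxE; under eq_bigr do rewrite !mxE.
  rewrite -(coordE_delta bb) {2}(coord_expand bE b`_i) linear_sum.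
  by apply: eq_bigr => a _; rewrite linearZ.
have GE : G = Q *m Q^T.
  apply/matrixP=> i j; rewrite !mxE gE; apply: eq_bigr => a _.
  by rewrite !mxE.
have GI : invmx G = P^T *m P.
  have G1 : G *m (P^T *m P) = 1%:M.
    by rewrite GE mulmxA -(mulmxA Q) -trmx_mul PQ trmx1 mulmx1.
  have /andP [uG _] : (G \in unitmx) && (P^T *m P \in unitmx).
    by apply/andP; exact: mulmx1_unit.
  by rewrite -[RHS](mulKmx uG) G1 mulmx1.
transitivity (\sum_(f : {ffun 'I_k -> 'I_(\dim {:W})})
  \sum_(h : {ffun 'I_k -> 'I_(\dim {:W})}) \sum_(c : {ffun 'I_k -> 'I_n})
   (\prod_a P (c a) (f a) * al (fun a => b`_(f a))) *
   (\prod_a P (c a) (h a) * be (fun a => b`_(h a)))).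
  apply: eq_bigr => f _; apply: eq_bigr => h _.
  rewrite GI; under eq_bigr do (rewrite !mxE; under eq_bigr do rewrite mxE).
  rewrite bigA_distr_bigA big_distrl /=; apply: eq_bigr => c _.
  by rewrite big_split /= mulrACA.
under eq_bigr do rewrite exchange_big /=.
rewrite exchange_big /=; apply: eq_bigr => c _.
under eq_bigr do rewrite -big_distrr /=.
rewrite -big_distrl /=.
pose bf (j : 'I_(\dim {:W})) : W := b`_j.
rewrite -(multilinear_expand bf (fun a => P (c a)) ml).
rewrite -(multilinear_expand bf (fun a => P (c a)) ml').
have eE : (fun i => \sum_j P (c i) j *: bf j) = fun a => E`_(c a).
  apply: funext => i; rewrite [RHS](coord_expand bb).
  by apply: eq_bigr => j _; rewrite mxE.
by rewrite eE.
Qed.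

End InnerForm.

(** The Hodge dual of phi in an adapted basis. *)
Definition formal_star : formal :=
  [:: (1, [:: 0; 1; 2; 3]%N); (1, [:: 0; 1; 4; 5]%N); (1, [:: 2; 3; 4; 5]%N);
      (-1, [:: 1; 3; 5; 6]%N); (1, [:: 1; 2; 4; 6]%N); (1, [:: 0; 3; 4; 6]%N);
      (1, [:: 0; 2; 5; 6]%N)].

Definition all7 (P : nat -> bool) := all P (iota 0 7).

Lemma all7P (P : nat -> bool) i : all7 P -> (i < 7)%N -> P i.
Proof. by move/allP => h lt; apply: h; rewrite mem_iota. Qed.

Lemma formal_star_check : all7 (fun a => all7 (fun b => all7 (fun c => all7 (fun d =>
   formal_val formal_star [:: a; b; c; d] == star_coef [:: a; b; c; d])))).
Proof. by vm_compute. Qed.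

Section G2.
Variables (F : numFieldType) (W : vectType F) (E : 7.-tuple W).
Variables (phi : kform W 3) (vol : kform W 7).
Hypothesis ad : adapted_basis phi vol E.

Let bE : basis_of {:W} E. Proof. by case: ad. Qed.

Lemma adapted_phi_alt : is_altform phi.
Proof. by rewrite (adapted_phi ad); apply: eval_formal_alt. Qed.

Lemma metric_basis i j v : (i < 7)%N -> (j < 7)%N ->
  wedge (wedge (contract E`_i phi) (contract E`_j phi)) phi v =
  6%:R * (i == j)%:R * vol v.
Proof.
move=> li lj; have := all7P (all7P metric_check li) lj => /and4P [w2 w4 w7 /eqP e].
rewrite (adapted_phi ad).
have wphi : wf_formal 3 formal_phi by [].
have c k : (k < 7)%N ->
    contract E`_k (eval_formal E 3 formal_phi) = eval_formal E 2 (formal_contract k formal_phi).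
  by move=> lk; apply: funext => w; rewrite (eval_formal_contract bE).
rewrite !c //.
have -> : wedge (eval_formal E 2 (formal_contract i formal_phi))
      (eval_formal E 2 (formal_contract j formal_phi)) =
   eval_formal E 4 (formal_wedge (formal_contract i formal_phi) (formal_contract j formal_phi)).
  by apply: funext => w; apply: eval_formal_wedge.
rewrite eval_formal_wedge // (eval_formal_top bE) // e (adapted_vol ad); congr (_ * _).
by case: eqP => _; rewrite ?mulr1 ?mulr0.
Qed.

(** Both sides are bilinear in x and y, so [metric_basis] suffices. *)
Lemma metric_formula x y v :
  6%:R^-1 * wedge (wedge (contract x phi) (contract y phi)) phi v =
  dot E x y * vol v.
Proof.
have cE z : contract z phi = fun w => \sum_i coord E i z * contract E`_i phi w.
  apply: funext => w; rewrite {1}(coord_expand bE z) contract_sum //.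
  exact: adapted_phi_alt.1.
have -> : wedge (contract x phi) (contract y phi) = fun w =>
   \sum_i coord E i x * \sum_j coord E j y *
      wedge (contract E`_i phi) (contract E`_j phi) w.
  apply: funext => w; rewrite (cE x) wedge_suml; apply: eq_bigr => i _.
  by rewrite (cE y) wedge_sumr.
have s6 : (6%:R : F) != 0 by rewrite pnatr_eq0.
apply: (mulfI s6); rewrite mulrA divff // mul1r wedge_suml /dot.
rewrite big_distrl big_distrr; apply: eq_bigr => i _ /=.
rewrite wedge_suml (bigD1 i) //= big1 => [|j ne]; last first.
  by rewrite metric_basis // eq_sym (negPf (ne : (j : nat) != i)) mulr0 mul0r mulr0.
by rewrite metric_basis // eqxx addr0 mulr1n; ring.
Qed.

Lemma induced_metric_dot (g : W -> W -> F) :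
  induced_metric phi vol g -> forall x y, g x y = dot E x y.
Proof.
by move=> h x y; have := h x y (fun i => E`_i);
  rewrite metric_formula (adapted_volE bE ad) !mulr1.
Qed.

Definition index_seq (f : {ffun 'I_4 -> 'I_7}) : seq nat :=
  [seq val (f i) | i <- enum 'I_4].

Lemma nth_index_seq (f : {ffun _ -> _}) (i : 'I_4) : nth 0%N (index_seq f) i = f i.
Proof. by rewrite (nth_map i) ?size_enum_ord // nth_ord_enum. Qed.

Lemma size_index_seq f : size (index_seq f) = 4%N.
Proof. by rewrite size_map size_enum_ord. Qed.

Lemma index_seq_lt f : all (fun a => a < 7)%N (index_seq f).
Proof. by apply/allP => a /mapP [i _ ->]; apply: ltn_ord. Qed.

Lemma coframe_form_index (f : {ffun _ -> _}) :
  coframe_form E f = nat_form E 4 (index_seq f).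
Proof.
apply: funext => v; rewrite /nat_form; congr (coframe_form _ _ _).
by apply: funext => i; rewrite nth_index_seq inord_val.
Qed.

Lemma wedge_phi_coframe (f : {ffun _ -> _}) v :
  wedge phi (coframe_form E f) v = (star_coef (index_seq f))%:~R * vol v.
Proof.
rewrite coframe_form_index (adapted_phi ad) (adapted_vol ad).
have -> : nat_form E 4 (index_seq f) = eval_formal E 4 [:: (1, index_seq f)].
  by apply: funext => w; rewrite /eval_formal big_seq1 mul1r.
rewrite eval_formal_wedge // (eval_formal_top bE) //.
apply: (@wf_formal_wedge 3 4) => //.
by rewrite /wf_formal /= size_index_seq index_seq_lt.
Qed.

Lemma wedge_phi al v : is_altform al ->
  wedge phi al v = (4`!%:R)^-1 *
   (\sum_(f : {ffun 'I_4 -> 'I_7}) al (fun i => E`_(f i)) *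
      (star_coef (index_seq f))%:~R) * vol v.
Proof.
move=> aal.
have e : al = fun w => \sum_(f : {ffun 'I_4 -> 'I_7})
    ((4`!%:R)^-1 * al (fun i => E`_(f i))) * coframe_form E f w.
  apply: funext => w; rewrite {1}(altform_expand bE) // big_distrr.
  by apply: eq_bigr => f _ /=; rewrite mulrA.
rewrite {1}e wedge_sumr -mulrA big_distrl big_distrr; apply: eq_bigr => f _ /=.
by rewrite wedge_phi_coframe -!mulrA.
Qed.

Definition at_basis (al : kform W 4) (t : seq nat) := al (fun i => E`_(nth 0%N t i)).

Lemma at_basis_index al (f : {ffun 'I_4 -> 'I_7}) :
  al (fun i => E`_(f i)) = at_basis al (index_seq f).
Proof. by congr al; apply: funext => i; rewrite nth_index_seq. Qed.

(** Test the Hodge star on the form E^t and on the arguments E_1, ..., E_7: as the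
basis is orthonormal, the inner product with E^t is the evaluation on the
basis vectors listed in t. *)
Lemma hodge_star_values (g : W -> W -> F) (star : kform W 4) :
  (forall x y, g x y = dot E x y) ->
  is_hodge_star (k := 3) (l := 4) g vol phi star ->
  forall t, size t = 4%N -> all (fun a => a < 7)%N t -> at_basis star t = (star_coef t)%:~R.
Proof.
move=> gE [alt h] t st lt.
(* The form E^t, with t as a finite function. *)
pose f : {ffun 'I_4 -> 'I_7} := [ffun i : 'I_4 => inord (nth 0%N t i)].
have tf : index_seq f = t.
  apply: (@eq_from_nth _ 0%N) => [|i]; rewrite size_index_seq ?st // => li.
  transitivity (f (Ordinal li) : nat); first by rewrite -nth_index_seq.
  rewrite ffunE inordK //=.
  by apply: (allP lt); rewrite mem_nth ?st.
have da := coframe_form_alt E f.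
have := h _ da (fun i => E`_i).
rewrite wedge_phi_coframe (adapted_volE bE ad) !mulr1 tf => ->.
rewrite (inner_form_orthonormal bE gE alt.1 da.1) -tf -at_basis_index.
rewrite (altform_expand bE) //; congr (_ * _); apply: eq_bigr => l _.
by rewrite (coframe_form_basis_sym bE).
Qed.

Lemma hodge_star_of_values (g : W -> W -> F) (star : kform W 4) :
  (forall x y, g x y = dot E x y) -> is_altform star ->
  (forall t, size t = 4%N -> all (fun a => a < 7)%N t ->
     at_basis star t = (star_coef t)%:~R) ->
  is_hodge_star (k := 3) (l := 4) g vol phi star.
Proof.
move=> gE alt h; split=> // al aal v; rewrite wedge_phi //; congr (_ * _).
rewrite (inner_form_orthonormal bE gE alt.1 aal.1); congr (_ * _).
apply: eq_bigr => f _; rewrite mulrC; congr (_ * _).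
by rewrite at_basis_index h ?size_index_seq ?index_seq_lt.
Qed.

Lemma hodge_star_formal (g : W -> W -> F) :
  (forall x y, g x y = dot E x y) ->
  is_hodge_star (k := 3) (l := 4) g vol phi (eval_formal E 4 formal_star).
Proof.
move=> gE; apply: hodge_star_of_values => // [|t st lt]; first exact: eval_formal_alt.
rewrite /at_basis (eval_formal_val bE) //; congr (_%:~R).
case: t st lt => [|a [|b [|c [|d []]]]] // _ lt.
have [la lb lc ld _] := and5P lt.
by have /eqP -> := all7P (all7P (all7P (all7P formal_star_check la) lb) lc) ld.
Qed.

End G2.

(** * Two quadratic identities for the three-form *)

(** Values of phi on basis vectors, and below those of its Hodge dual. They are
tabulated because the following verification needs them some hundred thousand
times. *)
Definition phi_table : seq (seq (seq int)) := Eval vm_compute in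
  [seq [seq [seq formal_val formal_phi [:: a; b; c]
    | c <- iota 0 7] | b <- iota 0 7] | a <- iota 0 7].
Definition star_table : seq (seq (seq (seq int))) := Eval vm_compute in
  [seq [seq [seq [seq star_coef [:: a; b; c; d]
    | d <- iota 0 7] | c <- iota 0 7] | b <- iota 0 7] | a <- iota 0 7].

Definition phi_lookup a b c : int := nth 0 (nth [::] (nth [::] phi_table a) b) c.
Definition star_lookup a b c d : int :=
  nth 0 (nth [::] (nth [::] (nth [::] star_table a) b) c) d.

(** The difference of the two sides of
  (1/2) (n ⌟ phi)^2 = g(n, n) star phi - n^♭ ∧ (n ⌟ star phi)
at the basis vectors x, y, z, w, where the two factors n are replaced by the
basis vectors n and m. It vanishes after symmetrisation in n and m only. *)
Definition square_defect (n m x y z w : nat) : int :=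
  let dl i j t : int := if i == j then t else 0 in
  phi_lookup n x y * phi_lookup m z w - phi_lookup n x z * phi_lookup m y w
  + phi_lookup n x w * phi_lookup m y z
  + (dl n x (star_lookup m y z w) + dl n z (star_lookup m x y w)
  - dl n m (star_lookup x y z w) - dl n y (star_lookup m x z w) - dl n w (star_lookup m x y z)).

Lemma square_check : all7 (fun n => all7 (fun m => (m < n)%N || all7 (fun x => all7 (fun y =>
  all7 (fun z => all7 (fun w => square_defect n m x y z w + square_defect m n x y z w == 0)))))).
Proof. by vm_compute. Qed.

Lemma phi_table_check : all7 (fun a => all7 (fun b => all7 (fun c =>
  formal_val formal_phi [:: a; b; c] == phi_lookup a b c))).
Proof. by vm_compute. Qed.

Lemma star_table_check : all7 (fun a => all7 (fun b => all7 (fun c => all7 (fun d =>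
  star_coef [:: a; b; c; d] == star_lookup a b c d)))).
Proof. by vm_compute. Qed.

(** The difference of the two sides of
  g(n × x, n × y) = g(n, n) g(x, y) - g(n, x) g(n, y)
for basis vectors, polarised in n; here g(n × x, y) = phi(n, x, y). *)
Definition cross_defect (n m x y : nat) : int :=
  foldr (fun k acc => phi_lookup n x k * phi_lookup m y k + acc) 0 (iota 0 7)
  + (if (n == y) && (m == x) then 1 else 0) - (if (n == m) && (x == y) then 1 else 0).

Lemma cross_check : all7 (fun n => all7 (fun m => all7 (fun x => all7 (fun y =>
  cross_defect n m x y + cross_defect m n x y == 0)))).
Proof. by vm_compute. Qed.

Section Curried.
Variables (F : numFieldType) (W : vectType F).

Definition vec3 (x y z : W) : 'I_3 -> W := fun i => nth 0 [:: x; y; z] i.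
Definition vec4 (x y z w : W) : 'I_4 -> W := fun i => nth 0 [:: x; y; z; w] i.

Lemma upd_vec3 x y z t : [/\ upd (vec3 x y z) ord0 t = vec3 t y z,
  upd (vec3 x y z) (lift ord0 ord0) t = vec3 x t z &
  upd (vec3 x y z) (lift ord0 (lift ord0 ord0)) t = vec3 x y t].
Proof. by split; apply: funext => -[[|[|[|]]]]. Qed.

Lemma upd_vec4 x y z w t : [/\ upd (vec4 x y z w) ord0 t = vec4 t y z w,
  upd (vec4 x y z w) (lift ord0 ord0) t = vec4 x t z w,
  upd (vec4 x y z w) (lift ord0 (lift ord0 ord0)) t = vec4 x y t w &
  upd (vec4 x y z w) (lift ord0 (lift ord0 (lift ord0 ord0))) t = vec4 x y z t].
Proof. by split; apply: funext => -[[|[|[|[|]]]]]. Qed.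

Lemma multilinear_vec3 (al : kform W 3) a t t' x y z : multilinear al ->
  (al (vec3 (a *: t + t') y z) = a * al (vec3 t y z) + al (vec3 t' y z)) *
  (al (vec3 x (a *: t + t') z) = a * al (vec3 x t z) + al (vec3 x t' z)) *
  (al (vec3 x y (a *: t + t')) = a * al (vec3 x y t) + al (vec3 x y t')).
Proof.
move=> ml; have u s := upd_vec3 x y z s.
have [<- <- <-] := u (a *: t + t'); have [<- <- <-] := u t; have [<- <- <-] := u t'.
by rewrite !ml.
Qed.

Lemma multilinear_vec4 (al : kform W 4) a t t' x y z w : multilinear al ->
  (al (vec4 (a *: t + t') y z w) = a * al (vec4 t y z w) + al (vec4 t' y z w)) *
  (al (vec4 x (a *: t + t') z w) = a * al (vec4 x t z w) + al (vec4 x t' z w)) *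
  (al (vec4 x y (a *: t + t') w) = a * al (vec4 x y t w) + al (vec4 x y t' w)) *
  (al (vec4 x y z (a *: t + t')) = a * al (vec4 x y z t) + al (vec4 x y z t')).
Proof.
move=> ml; have u s := upd_vec4 x y z w s.
have [<- <- <- <-] := u (a *: t + t'); have [<- <- <- <-] := u t.
have [<- <- <- <-] := u t'; by rewrite !ml.
Qed.

Variables (E : 7.-tuple W).
Hypothesis bE : basis_of {:W} E.

Lemma dot_basis i j : (i < 7)%N -> (j < 7)%N -> dot E E`_i E`_j = (i == j)%:R.
Proof.
move=> li lj; rewrite /dot (bigD1 (Ordinal li)) //= big1 => [|k ne].
  have := coordE_delta bE (Ordinal li) (Ordinal li); rewrite eqxx /= => ->.
  have := coordE_delta bE (Ordinal li) (Ordinal lj); rewrite -val_eqE /= => ->.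
  by rewrite mul1r addr0 eq_sym.
have := coordE_delta bE k (Ordinal li); rewrite eq_sym (negPf ne) /= => ->.
by rewrite mul0r.
Qed.

Lemma dotC x y : dot E x y = dot E y x.
Proof. by apply: eq_bigr => i _; rewrite mulrC. Qed.

Lemma dot_linl a x y z : dot E (a *: x + y) z = a * dot E x z + dot E y z.
Proof.
rewrite /dot big_distrr /= -big_split; apply: eq_bigr => i _ /=.
by rewrite linearP /= mulrDl mulrA.
Qed.

Lemma dot_linr a x y z : dot E z (a *: x + y) = a * dot E z x + dot E z y.
Proof. by rewrite dotC dot_linl !(dotC z). Qed.

Lemma dot_nondeg x : (forall y, dot E x y = 0) -> x = 0.
Proof.
move=> h; rewrite (coord_expand bE x) big1 // => i _.
have := h E`_i; rewrite /dot (bigD1 i) //= big1 => [|k ne].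
  by rewrite coordE_delta // eqxx mulr1 addr0 => ->; rewrite scale0r.
by rewrite coordE_delta // eq_sym (negPf ne) mulr0.
Qed.

Lemma linear_basis0 (h : W -> F) : (forall a x y, h (a *: x + y) = a * h x + h y) ->
  (forall i, (i < 7)%N -> h E`_i = 0) -> forall x, h x = 0.
Proof.
move=> hl h0 x.
have h00 : h 0 = 0.
  by have := hl (-1) 0 0; rewrite scaler0 addr0 mulN1r addNr.
rewrite (coord_expand bE x); elim/big_rec: _ => // i y _ IH.
by rewrite hl IH h0 // mulr0 addr0.
Qed.

Section G2.
Variables (phi : kform W 3) (vol : kform W 7) (star : kform W 4).
Hypothesis ad : adapted_basis phi vol E.
Hypothesis star_alt : is_altform star.
Hypothesis starE : forall t, size t = 4%N -> all (fun a => a < 7)%N t ->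
  at_basis E star t = (star_coef t)%:~R.

Lemma phi_basis a b c : (a < 7)%N -> (b < 7)%N -> (c < 7)%N ->
  phi (vec3 E`_a E`_b E`_c) = (phi_lookup a b c)%:~R.
Proof.
move=> la lb lc; have /eqP <- := all7P (all7P (all7P phi_table_check la) lb) lc.
rewrite (adapted_phi ad) -(@eval_formal_val _ _ _ bE 3) //= ?la ?lb ?lc //.
by congr eval_formal; apply: funext => -[[|[|[|]]]].
Qed.

Lemma star_basis a b c d : (a < 7)%N -> (b < 7)%N -> (c < 7)%N -> (d < 7)%N ->
  star (vec4 E`_a E`_b E`_c E`_d) = (star_lookup a b c d)%:~R.
Proof.
move=> la lb lc ld.
have /eqP <- := all7P (all7P (all7P (all7P star_table_check la) lb) lc) ld.
rewrite -starE //= ?la ?lb ?lc ?ld //.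
by congr star; apply: funext => -[[|[|[|[|]]]]].
Qed.

Local Notation "'P' x y z" := (phi (vec3 x y z)) (at level 10, x, y, z at level 9).
Local Notation "'S' x y z w" := (star (vec4 x y z w)) (at level 10, x, y, z, w at level 9).
Local Notation g := (dot E).

Let phi_lin :=
  (fun a t t' y z => (multilinear_vec3 a t t' 0 y z (adapted_phi_alt ad).1).1.1,
   fun a t t' x z => (multilinear_vec3 a t t' x 0 z (adapted_phi_alt ad).1).1.2,
   fun a t t' x y => (multilinear_vec3 a t t' x y 0 (adapted_phi_alt ad).1).2).

Let star_lin :=
  (fun a t t' y z w => (multilinear_vec4 a t t' 0 y z w star_alt.1).1.1.1,
   fun a t t' x z w => (multilinear_vec4 a t t' x 0 z w star_alt.1).1.1.2,
   fun a t t' x y w => (multilinear_vec4 a t t' x y 0 w star_alt.1).1.2,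
   fun a t t' x y z => (multilinear_vec4 a t t' x y z 0 star_alt.1).2).

Definition square_form n m x y z w :=
  P n x y * P m z w - P n x z * P m y w + P n x w * P m y z
  + (g n x * S m y z w + g n z * S m x y w
  - g n m * S x y z w - g n y * S m x z w - g n w * S m x y z).

Lemma square_form0 n m x y z w : square_form n m x y z w + square_form m n x y z w = 0.
Proof.
pose lin := (phi_lin, star_lin, dot_linl, dot_linr).
rewrite /square_form.
move: n; apply: linear_basis0 => [a n n'|in_ ln]; first by rewrite !lin; ring.
move: m; apply: linear_basis0 => [a n n'|im lm]; first by rewrite !lin; ring.
move: x; apply: linear_basis0 => [a n n'|ix lx]; first by rewrite !lin; ring.
move: y; apply: linear_basis0 => [a n n'|iy ly]; first by rewrite !lin; ring.
move: z; apply: linear_basis0 => [a n n'|iz lz]; first by rewrite !lin; ring.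
move: w; apply: linear_basis0 => [a n n'|iw lw]; first by rewrite !lin; ring.
rewrite !phi_basis ?star_basis ?dot_basis //.
wlog le : in_ im ln lm / (in_ <= im)%N.
  by case: (leqP in_ im) => h H; [apply: H|rewrite addrC; apply: H => //; apply: ltnW].
have := all7P (all7P square_check ln) lm; rewrite ltnNge le /= => h.
have /eqP := all7P (all7P (all7P (all7P h lx) ly) lz) lw.
move/(congr1 (fun t : int => t%:~R : F)); rewrite /square_defect.
have dl (i j : nat) (t : int) : (if i == j then t else 0)%:~R = (i == j)%:R * t%:~R :> F.
  by case: eqP => _; rewrite ?mul1r ?mul0r.
have iN (t : int) : (- t)%:~R = - (t%:~R) :> F by rewrite rmorphN.
rewrite !(intrD, intrM, iN, dl) => hq.
by apply: (etrans _ hq); ring.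
Qed.

(** For arguments orthogonal to n, the term n^♭ ∧ (n ⌟ star phi) of the identity
(1/2) (n ⌟ phi)^2 = g(n, n) star phi - n^♭ ∧ (n ⌟ star phi) is absent. *)
Lemma phi_square n x y z w :
  g n x = 0 -> g n y = 0 -> g n z = 0 -> g n w = 0 ->
  P n x y * P n z w - P n x z * P n y w + P n x w * P n y z = g n n * S x y z w.
Proof.
move=> h1 h2 h3 h4; have := square_form0 n n x y z w; rewrite /square_form h1 h2 h3 h4.
move/eqP; rewrite -mulr2n mulrn_eq0 /= !mul0r !(addr0, add0r, subr0) subr_eq0.
by move/eqP.
Qed.

(** The identity g(n × x, n × y) = g(n, n) g(x, y) - g(n, x) g(n, y) for the cross
product given by g(n × x, y) = phi(n, x, y). *)
Lemma phi_cross_norm n x y :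
  \sum_(k < 7) P n x E`_k * P n y E`_k = g n n * g x y - g n x * g n y.
Proof.
pose Q n m x y := \sum_(k < 7) P n x E`_k * P m y E`_k + g n y * g m x - g n m * g x y.
have Ql1 a n1 n2 m x1 y1 : Q (a *: n1 + n2) m x1 y1 = a * Q n1 m x1 y1 + Q n2 m x1 y1.
  rewrite /Q !dot_linl; under eq_bigr do rewrite phi_lin mulrDl -mulrA.
  rewrite big_split -big_distrr /=; ring.
have Ql2 a n1 n2 m x1 y1 : Q m (a *: n1 + n2) x1 y1 = a * Q m n1 x1 y1 + Q m n2 x1 y1.
  rewrite /Q !dot_linl !dot_linr; under eq_bigr do rewrite phi_lin mulrDr mulrCA.
  rewrite big_split -big_distrr /=; ring.
have Ql3 a n1 n2 m x1 y1 : Q m x1 (a *: n1 + n2) y1 = a * Q m x1 n1 y1 + Q m x1 n2 y1.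
  rewrite /Q !dot_linl !dot_linr; under eq_bigr do rewrite phi_lin mulrDl -mulrA.
  rewrite big_split -big_distrr /=; ring.
have Ql4 a n1 n2 m x1 y1 : Q m x1 y1 (a *: n1 + n2) = a * Q m x1 y1 n1 + Q m x1 y1 n2.
  rewrite /Q !dot_linr; under eq_bigr do rewrite phi_lin mulrDr mulrCA.
  rewrite big_split -big_distrr /=; ring.
have Q0 n1 m x1 y1 : Q n1 m x1 y1 + Q m n1 x1 y1 = 0.
  move: n1; apply: linear_basis0 => [a s t|in_ ln]; first by rewrite Ql1 Ql2; ring.
  move: m; apply: linear_basis0 => [a s t|im lm]; first by rewrite Ql1 Ql2; ring.
  move: x1; apply: linear_basis0 => [a s t|ix lx]; first by rewrite !Ql3; ring.
  move: y1; apply: linear_basis0 => [a s t|iy ly]; first by rewrite !Ql4; ring.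
  have /eqP := all7P (all7P (all7P (all7P cross_check ln) lm) lx) ly.
  move/(congr1 (fun t : int => t%:~R : F)).
  have iN (t : int) : (- t)%:~R = - (t%:~R) :> F by rewrite rmorphN.
  have QE i j : (i < 7)%N -> (j < 7)%N -> Q E`_i E`_j E`_ix E`_iy = (cross_defect i j ix iy)%:~R.
    move=> li lj.
    have fs : foldr (fun k acc => phi_lookup i ix k * phi_lookup j iy k + acc) 0 (iota 0 7) =
              \sum_(k < 7) phi_lookup i ix k * phi_lookup j iy k.
      by rewrite -(big_mkord xpredT (fun k => phi_lookup i ix k * phi_lookup j iy k))
        -(foldr_if_sum xpredT).
    rewrite /Q /cross_defect fs !dot_basis // intrD iN intrD rmorph_sum /=.
    congr (_ + _ - _); first by apply: eq_bigr => k _; rewrite !phi_basis // intrM.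
      by do 2!case: eqP => _; rewrite ?mulr1 ?mulr0.
    by do 2!case: eqP => _; rewrite ?mulr1 ?mulr0.
  by rewrite intrD -!QE.
have := Q0 n n x y; move/eqP; rewrite -mulr2n mulrn_eq0 /= /Q subr_eq0 => /eqP <-.
by ring.
Qed.

End G2.
End Curried.

(** * Symplectic bases *)

Section Bilinear.
Variables (F : fieldType) (U : vectType F).

Definition bilin (f : U -> U -> F) :=
  (forall a x y z, f (a *: x + y) z = a * f x z + f y z) /\
  (forall a x y z, f z (a *: x + y) = a * f z x + f z y).

Lemma bilin_biscalar f : bilin f -> exists w : {biscalar U}, forall x y, w x y = f x y.
Proof.
move=> [hl hr].
have b : bilinear_for *%R *%R f by split=> [u' a x y|u a x y]; [apply: hl|apply: hr].
pose m := bilinear_isBilinear.Build F U U F *%R *%R f b.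
pose w : {biscalar U} := HB.pack_for {biscalar U} f m.
by exists w.
Qed.

Lemma biscalar_bilin (w : {biscalar U}) : bilin w.
Proof. by split=> a x y z; rewrite ?linearPl ?linearPr. Qed.

Variable f : U -> U -> F.
Hypothesis bf : bilin f.

Lemma bilin0l z : f 0 z = 0.
Proof. by have := bf.1 (-1) 0 0 z; rewrite scaler0 addr0 mulN1r addNr. Qed.

Lemma bilin0r z : f z 0 = 0.
Proof. by have := bf.2 (-1) 0 0 z; rewrite scaler0 addr0 mulN1r addNr. Qed.

Lemma bilinDl x y z : f (x + y) z = f x z + f y z.
Proof. by have := bf.1 1 x y z; rewrite scale1r mul1r. Qed.

Lemma bilinDr x y z : f z (x + y) = f z x + f z y.
Proof. by have := bf.2 1 x y z; rewrite scale1r mul1r. Qed.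

Lemma bilinZl a x z : f (a *: x) z = a * f x z.
Proof. by rewrite -[a *: x]addr0 bf.1 bilin0l addr0. Qed.

Lemma bilinZr a x z : f z (a *: x) = a * f z x.
Proof. by rewrite -[a *: x]addr0 bf.2 bilin0r addr0. Qed.

Definition bilinE := (bilinDl, bilinDr, bilinZl, bilinZr).

Lemma bilin_suml (I : Type) (r : seq I) (c : I -> F) (X : I -> U) z :
  f (\sum_(i <- r) c i *: X i) z = \sum_(i <- r) c i * f (X i) z.
Proof. by elim/big_rec2: _ => [|i y x _ <-]; rewrite ?bilin0l // bf.1. Qed.

Lemma bilin_sumr (I : Type) (r : seq I) (c : I -> F) (X : I -> U) z :
  f z (\sum_(i <- r) c i *: X i) = \sum_(i <- r) c i * f z (X i).
Proof. by elim/big_rec2: _ => [|i y x _ <-]; rewrite ?bilin0r // bf.2. Qed.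

Lemma bilin_alt_anti : (forall x, f x x = 0) -> forall x y, f x y = - f y x.
Proof.
move=> h x y; have := h (1 *: x + y).
rewrite bf.1 !bf.2 !mul1r !h add0r addr0 => /eqP.
by rewrite addr_eq0 => /eqP.
Qed.

End Bilinear.

(** A form of [lfunE] for functions whose linearity is a hypothesis instead of a
canonical structure. *)
Lemma linfun_linearE (F : fieldType) (U V : vectType F) (h : U -> V) :
  (forall a x y, h (a *: x + y) = a *: h x + h y) -> forall x, linfun h x = h x.
Proof.
move=> hl x.
pose m := GRing.isLinear.Build F U V *:%R h hl.
pose l : {linear U -> V} := HB.pack_for {linear U -> V} h m.
by rewrite -[linfun h]/(linfun l) lfunE.
Qed.

Section Symplectic.
Variables (F : fieldType) (U : vectType F).

(** The Gram matrix of a basis x_1, y_1, x_2, y_2, ... in which the planes spanned by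
the x_i, y_i are mutually orthogonal and f x_i y_i = 1. *)
Definition std_sympl (i j : nat) : F :=
  if odd i then - (i == j.+1)%:R else (j == i.+1)%:R.

Definition sympl_gram (f : U -> U -> F) (s : seq U) :=
  ~~ odd (size s) /\ forall i j, (i < size s)%N -> (j < size s)%N ->
    f s`_i s`_j = std_sympl i j.

(** Split off a plane spanned by x and y with f x y = 1; the two-form remains
non-degenerate on the orthogonal complement of this plane in V. *)
Lemma sympl_seq (f : U -> U -> F) : bilin f -> (forall x, f x x = 0) ->
  forall V : {vspace U}, nondegenerate_on f V ->
  exists2 s : seq U, (<<s>> = V)%VS & sympl_gram f s.
Proof.
move=> bf fxx V; have anti := bilin_alt_anti bf fxx.
have [m] := ubnP (\dim V); elim: m V => // m IH V lt_m nd.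
have [V0|Vn0] := eqVneq V 0%VS.
  by exists [::] => //; rewrite span_nil V0.
pose x := vpick V; have xV : x \in V := memv_pick V.
have xn0 : x != 0 by rewrite vpick0.
(* Non-degeneracy gives a partner of x, which is then rescaled. *)
have [y yV fxy] : exists2 y, y \in V & f x y = 1.
  have : ~ (forall y, y \in V -> f x y = 0).
    by move=> h; move/eqP: xn0; apply; apply: nd.
  move=> /existsNP [y /not_implyP [yV /eqP fxy]].
  by exists ((f x y)^-1 *: y); rewrite ?memvZ ?(bilinE bf) ?mulVf.
have fyx : f y x = -1 by rewrite anti fxy.
(* The projection to the orthogonal complement of the plane spanned by x and y. *)
pose p v : U := v + (- f v y *: x + f v x *: y).
have pl a v v' : p (a *: v + v') = a *: p v + p v'.
  rewrite /p !bf.1 scalerDr [RHS]addrACA; congr (_ + _).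
  by rewrite scalerDr !scalerA [RHS]addrACA -!scalerDl; congr (_ *: _ + _ *: _); ring.
pose l := linfun p; have lE := linfun_linearE pl.
pose V' := (l @: V)%VS.
have pV v : v \in V -> p v \in V'.
  by move=> vV; rewrite -lE memv_img.
have pVV v : v \in V -> p v \in V by move=> vV; rewrite !(memvD, memvZ).
have V'V v : v \in V' -> [/\ v \in V, f v x = 0 & f v y = 0].
  case/memv_imgP=> z zV ->; rewrite lE; split; first exact: pVV.
    by rewrite /p !(bilinE bf) fxx fyx; ring.
  by rewrite /p !(bilinE bf) fxx fxy; ring.
have V'sub : (V' <= V)%VS by apply/subvP => v /V'V [].
have xnV' : x \notin V'.
  by apply/negP => /V'V [_ _ /eqP]; rewrite fxy oner_eq0.
have ltV' : (\dim V' < m)%N.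
  apply: leq_trans (_ : \dim V <= m)%N => //; rewrite ltnNge.
  apply: contra xnV' => le; have /eqP -> // : V' == V by rewrite eqEdim V'sub.
have ndV' : nondegenerate_on f V'.
  move=> w wV' h; have [wV wx wy] := V'V _ wV'; apply: nd => // v vV.
  have {1}-> : v = 1 *: p v + (f v y *: x + (- f v x) *: y).
    rewrite /p scale1r !scaleNr; move: (_ *: x) (_ *: y) => A B.
    by rewrite -addrA addrACA addNr subrr !addr0.
  by rewrite (bilinDr bf) (bilinZr bf 1) (h (p v)) ?pV // !(bilinE bf) wx wy; ring.
have [s sV' [es gs]] := IH V' ltV' ndV'.
have sm z : z \in s -> z \in V' by move=> zs; rewrite -sV' memv_span.
exists [:: x, y & s].
  apply/eqP; rewrite eqEsubv !span_cons sV'; apply/andP; split.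
    by rewrite !subv_add V'sub -!memvE xV yV.
  apply/subvP => v vV.
  have {1}-> : v = f v y *: x + ((- f v x) *: y + p v).
    rewrite /p !scaleNr; move: (_ *: x) (_ *: y) => A B.
    by rewrite (addrCA (- B) v) (addrCA (- B)) addNr addr0 addrCA subrr addr0.
  apply: memv_add; first by rewrite memvZ ?memv_line.
  apply: memv_add; last exact: pV.
  by apply: memvZ; apply: memv_line.
split; first by rewrite /= negbK.
have s0 i : (i < size s)%N -> [/\ f s`_i x = 0 & f s`_i y = 0].
  by move=> li; have [] := V'V _ (sm _ (mem_nth 0 li)).
case=> [|[|i]] [|[|j]] //= li lj; rewrite ?fxx ?fxy ?fyx /std_sympl /= ?oppr0 //.
- by rewrite anti; have [-> _] := s0 j lj; rewrite oppr0.
- by rewrite anti; have [_ ->] := s0 j lj; rewrite !oppr0.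
- by have [-> _] := s0 i li; case: ifP; rewrite ?oppr0.
- by have [_ ->] := s0 i li; case: i li => [|i] _ //=; case: ifP; rewrite ?oppr0.
- by rewrite gs // /std_sympl negbK.
Qed.

(** Pairing a linear relation with the partner of the i-th vector isolates the i-th
coefficient. *)
Lemma sympl_free (f : U -> U -> F) (s : seq U) : bilin f -> sympl_gram f s -> free s.
Proof.
move=> bf [ev gs]; rewrite -[s]/(val (in_tuple s)); apply/freeP => k k0 i.
pose p := if odd i then i.-1 else i.+1.
have lp : (p < size s)%N.
  rewrite /p; case: ifP => oi; first by apply: leq_ltn_trans (leq_pred _) (ltn_ord i).
  rewrite ltn_neqAle ltn_ord andbT; apply/eqP => e.
  by move: ev; rewrite -e /= oi.
have /eqP := congr1 (f^~ s`_p) k0; rewrite bilin_suml // bilin0l //.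
rewrite (bigD1 i) //= big1 => [|j ne].
  rewrite addr0 gs // mulf_eq0 => /orP [/eqP // |].
  case oi: (odd i); rewrite /std_sympl /p oi; last by rewrite eqxx oner_eq0.
  by rewrite prednK ?eqxx ?oppr_eq0 ?oner_eq0 //; case: (i : nat) oi.
case oj: (odd j); case oi: (odd i); rewrite gs // /std_sympl /p oj oi.
- rewrite (_ : (_ == _) = false) ?oppr0 ?mulr0 //; apply: contraNF ne => /eqP h.
  by apply/eqP/val_inj; rewrite /= h prednK //; case: (i : nat) oi.
- rewrite (_ : (_ == _) = false) ?oppr0 ?mulr0 //; apply/eqP => h.
  by move: oj; rewrite h /= oi.
- rewrite (_ : (_ == _) = false) ?mulr0 //; apply/eqP => h.
  have ij : i = j.+2 :> nat by rewrite -h prednK //; case: (i : nat) oi.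
  by move: oi; rewrite ij /= oj.
- rewrite (_ : (_ == _) = false) ?mulr0 //; apply: contraNF ne => /eqP h.
  by apply/eqP/val_inj; case: h.
Qed.

Lemma sympl_basis (w : {biscalar U}) : nondegenerate_2form w ->
  exists2 s : seq U, basis_of {:U} s & sympl_gram w s.
Proof.
move=> [wxx nd]; have bw := biscalar_bilin w.
have [s es gs] := sympl_seq bw wxx nd; exists s => //.
by rewrite basisEfree (sympl_free bw gs) es subvv /= -es; apply/dim_span.
Qed.

End Symplectic.

(** * Endomorphisms preserving a two-form *)

Section SimilarSp.
Variables (F : fieldType) (U : vectType F).

(** The condition which connects the three statements of the theorem: it mentions
neither a given two-form nor a metric nor Jordan blocks. *)
Definition preserves_sympl (A : 'End(U)) :=
  exists2 w : {biscalar U}, nondegenerate_2form w & in_sp w A.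

(** Map a symplectic basis of w to a symplectic basis of w'. *)
Lemma sympl_isometry (w w' : {biscalar U}) :
  nondegenerate_2form w -> nondegenerate_2form w' ->
  exists2 h : 'End(U), lker h == 0%VS & forall x y, w' (h x) (h y) = w x y.
Proof.
move=> nw nw'; have [s bs [_ gs]] := sympl_basis nw.
have [s' bs' [_ gs']] := sympl_basis nw'.
have bw := biscalar_bilin w; have bw' := biscalar_bilin w'.
have ess : size s' = size s.
  by rewrite -(size_basis (X := in_tuple s') bs') -(size_basis (X := in_tuple s) bs).
pose h0 x := \sum_(i < size s) coord (in_tuple s) i x *: s'`_i.
have hl a x y : h0 (a *: x + y) = a *: h0 x + h0 y.
  rewrite /h0 scaler_sumr -big_split; apply: eq_bigr => i _ /=.
  by rewrite linearP /= scalerDl scalerA.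
pose h := linfun h0; have hE := linfun_linearE hl.
have iso x y : w' (h x) (h y) = w x y.
  rewrite [in RHS](coord_basis (X := in_tuple s) bs (memvf x)).
  rewrite [in RHS](coord_basis (X := in_tuple s) bs (memvf y)).
  rewrite !hE /h0 !bilin_suml //; apply: eq_bigr => i _; congr (_ * _).
  rewrite !bilin_sumr //; apply: eq_bigr => j _; congr (_ * _).
  by rewrite gs // gs' ?ess.
exists h => //; apply/lker0P => x y exy; apply/eqP; rewrite -subr_eq0; apply/eqP.
apply: nw.2; rewrite ?memvf // => z _; rewrite -iso linearB /= exy subrr.
exact: bilin0l.
Qed.

(** Conjugating by h transports preserved two-forms along h; by [sympl_isometry] any
preserved non-degenerate two-form can be transported to w. *)
Lemma similar_sp_iff (w : {biscalar U}) (A : 'End(U)) : nondegenerate_2form w ->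
  (exists2 f : 'End(U), in_sp w f & similar_end A f) <-> preserves_sympl A.
Proof.
move=> nw; split=> [[f sf [h h0 ->]]|[w' nw' sA]].
  have bw := biscalar_bilin w.
  have [w' w'E] : exists w' : {biscalar U},
      forall x y, w' x y = w ((h^-1)%VF x) ((h^-1)%VF y).
    by apply: bilin_biscalar; split=> a x y z; rewrite linearP /= ?bw.1 ?bw.2.
  exists w'; last first.
    by move=> x y; rewrite !w'E !lfunE /= !lfunE /= !lker0_lfunK ?sf.
  split=> [x|x _ xy]; first by rewrite w'E nw.1.
  rewrite -[x](lker0_lfunVK h0) (nw.2 ((h^-1)%VF x)) ?linear0 ?memvf // => y _.
  by have := xy (h y) (memvf _); rewrite w'E lker0_lfunK.
have [h h0 iso] := sympl_isometry nw nw'.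
exists (h^-1 \o (A \o h))%VF.
  by move=> x y; rewrite -!iso !lfunE /= !lker0_lfunVK // !lfunE /= sA.
exists h => //; rewrite !comp_lfunA lker0_compfV // comp_lfun1l.
by rewrite -comp_lfunA lker0_compfV // comp_lfun1r.
Qed.

End SimilarSp.

Section WedgeInjective.
Variables (F : numFieldType) (U : vectType F).
Variables (f al : U -> U -> F) (s : seq U).

(** The last hypothesis says that al ∧ f = 0. There are three mutually orthogonal
planes. If s_i and s_j lie in different planes, evaluating al ∧ f on s_i, s_j and
the vectors of a plane containing neither gives al(s_i, s_j) = 0. The values of al
on the three planes add up to zero in pairs, so they vanish too. *)
Lemma sympl_wedge_inj : bilin f -> bilin al -> (forall x, al x x = 0) ->
  basis_of {:U} s -> sympl_gram f s -> size s = 6%N ->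
  (forall x y z t, al x y * f z t - al x z * f y t + al x t * f y z
     + (al y z * f x t - al y t * f x z + al z t * f x y) = 0) ->
  forall x y, al x y = 0.
Proof.
move=> bf ba axx bs [_ gs] s6 H.
have anti := bilin_alt_anti ba axx; rewrite s6 in gs.
have E i j k l := H s`_i s`_j s`_k s`_l.
have a02 : al s`_0 s`_2 = 0.
  by have := E 0%N 2%N 4%N 5%N; rewrite !gs // /std_sympl /= => h; apply: (etrans _ h); ring.
have a03 : al s`_0 s`_3 = 0.
  by have := E 0%N 3%N 4%N 5%N; rewrite !gs // /std_sympl /= => h; apply: (etrans _ h); ring.
have a04 : al s`_0 s`_4 = 0.
  by have := E 0%N 4%N 2%N 3%N; rewrite !gs // /std_sympl /= => h; apply: (etrans _ h); ring.
have a05 : al s`_0 s`_5 = 0.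
  by have := E 0%N 5%N 2%N 3%N; rewrite !gs // /std_sympl /= => h; apply: (etrans _ h); ring.
have a12 : al s`_1 s`_2 = 0.
  by have := E 1%N 2%N 4%N 5%N; rewrite !gs // /std_sympl /= => h; apply: (etrans _ h); ring.
have a13 : al s`_1 s`_3 = 0.
  by have := E 1%N 3%N 4%N 5%N; rewrite !gs // /std_sympl /= => h; apply: (etrans _ h); ring.
have a14 : al s`_1 s`_4 = 0.
  by have := E 1%N 4%N 2%N 3%N; rewrite !gs // /std_sympl /= => h; apply: (etrans _ h); ring.
have a15 : al s`_1 s`_5 = 0.
  by have := E 1%N 5%N 2%N 3%N; rewrite !gs // /std_sympl /= => h; apply: (etrans _ h); ring.
have a24 : al s`_2 s`_4 = 0.
  by have := E 2%N 4%N 0%N 1%N; rewrite !gs // /std_sympl /= => h; apply: (etrans _ h); ring.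
have a25 : al s`_2 s`_5 = 0.
  by have := E 2%N 5%N 0%N 1%N; rewrite !gs // /std_sympl /= => h; apply: (etrans _ h); ring.
have a34 : al s`_3 s`_4 = 0.
  by have := E 3%N 4%N 0%N 1%N; rewrite !gs // /std_sympl /= => h; apply: (etrans _ h); ring.
have a35 : al s`_3 s`_5 = 0.
  by have := E 3%N 5%N 0%N 1%N; rewrite !gs // /std_sympl /= => h; apply: (etrans _ h); ring.
have p02 : al s`_0 s`_1 + al s`_2 s`_3 = 0.
  by have := E 0%N 1%N 2%N 3%N; rewrite !gs // /std_sympl /= => h; apply: (etrans _ h); ring.
have p04 : al s`_0 s`_1 + al s`_4 s`_5 = 0.
  by have := E 0%N 1%N 4%N 5%N; rewrite !gs // /std_sympl /= => h; apply: (etrans _ h); ring.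
have p24 : al s`_2 s`_3 + al s`_4 s`_5 = 0.
  by have := E 2%N 3%N 4%N 5%N; rewrite !gs // /std_sympl /= => h; apply: (etrans _ h); ring.
have two (a b c : F) : a + b = 0 -> a + c = 0 -> b + c = 0 -> a = 0.
  move=> e1 e2 e3; have : 2%:R * a = (a + b) + (a + c) - (b + c) by ring.
  rewrite e1 e2 e3 addr0 subr0.
  by move/eqP; rewrite mulf_eq0 pnatr_eq0 /= => /eqP.
have a01 := two _ _ _ p02 p04 p24.
have a23 : al s`_2 s`_3 = 0 by rewrite a01 add0r in p02.
have a45 : al s`_4 s`_5 = 0 by rewrite a01 add0r in p04.
have Z : forall i j, (i < 6)%N -> (j < 6)%N -> al s`_i s`_j = 0.
  have Zlt i j : (i < j)%N -> (j < 6)%N -> al s`_i s`_j = 0.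
    by case: i j => [|[|[|[|[|[|i]]]]]] [|[|[|[|[|[|j]]]]]].
  move=> i j li lj; case: (ltngtP i j) => [lt|gt|->]; first exact: Zlt.
    by rewrite anti Zlt ?oppr0.
  exact: axx.
move=> x y; rewrite (coord_basis (X := in_tuple s) bs (memvf x)).
rewrite (coord_basis (X := in_tuple s) bs (memvf y)).
rewrite bilin_suml // big1 // => i _; rewrite bilin_sumr // big1 ?mulr0 // => j _.
by rewrite Z ?mulr0 // -s6.
Qed.
End WedgeInjective.

(** * The differential of a four-form *)

Section ExtD.
Variables (F : numFieldType) (L : vectType F) (br : {bilinear L -> L -> L}).

Definition vec5 (x y z w t : L) : 'I_5 -> L := fun i => nth 0 [:: x; y; z; w; t] i.

Lemma vec5_eta (X : 'I_5 -> L) : exists x y z w t, X = vec5 x y z w t.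
Proof.
exists (X ord0), (X (inord 1)), (X (inord 2)), (X (inord 3)), (X (inord 4)).
apply: funext => -[[|[|[|[|[|]]]]] lt] //; rewrite /vec5 /=;
  by congr X; apply/val_inj; rewrite /= ?inordK.
Qed.

Lemma ext_d_vec5 (al : kform L 4) x y z w t :
  ext_d (m := 3) br al (vec5 x y z w t) =
  - al (vec4 (br x y) z w t) + al (vec4 (br x z) y w t) - al (vec4 (br x w) y z t)
  + al (vec4 (br x t) y z w) - al (vec4 (br y z) x w t) + al (vec4 (br y w) x z t)
  - al (vec4 (br y t) x z w) - al (vec4 (br z w) x y t) + al (vec4 (br z t) x y w)
  - al (vec4 (br w t) x y z).
Proof.
rewrite /ext_d.
have vE (b : L) (c : 'I_3 -> L) : vcons b c =
    vec4 b (c ord0) (c (lift ord0 ord0)) (c (lift ord0 (lift ord0 ord0))).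
  apply: funext => i; case: (unliftP ord0 i) => [j|] ->; rewrite ?vcons0 // vconsS.
  by case: j => -[|[|[|]]] // lt; rewrite /vec4 /=; congr c; apply/val_inj.
under eq_bigr do (under eq_bigr do rewrite vE; rewrite big_mkcond).
rewrite !big_ord_recl !big_ord0 /= /vec5 /bump /=.
ring.
Qed.

Variables (u : {vspace L}) (e : L).
Hypothesis hbr : forall x, br x x = 0.
Hypothesis hu : abelian_ideal br u.
Hypothesis hcodim : (\dim u).+1 = \dim {:L}.
Hypothesis he : e \notin u.

Lemma full_decomp : (u + <[e]>)%VS = fullv.
Proof.
apply/eqP; rewrite eqEdim subvf /= -hcodim.
have lt : (\dim u < \dim (u + <[e]>))%N.
  rewrite ltn_neqAle (dimv_leqif_sup (addvSl u <[e]>%VS)) dimvS ?addvSl // andbT.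
  by apply: contra he => /subvP h; apply: h; rewrite memvE addvSr.
exact: lt.
Qed.

Lemma transverse_coord : exists c : L -> F,
  [/\ forall a x y, c (a *: x + y) = a * c x + c y,
      forall x, x - c x *: e \in u, c e = 1 & forall x, x \in u -> c x = 0].
Proof.
have en0 : e != 0 by apply: contraNneq he => ->; apply: mem0v.
have mult0 a : a *: e \in u -> a = 0.
  move=> h; apply/eqP; apply: contraR he => an0.
  by rewrite -[e](scalerK an0) memvZ.
have dis : (<[e]> :&: u)%VS = 0%VS.
  apply/eqP; rewrite -subv0; apply/subvP => x /memv_capP [/vlineP [a ->] /mult0 ->].
  by rewrite scale0r mem0v.
pose c x := coord [tuple e] ord0 (daddv_pi <[e]>%VS u x).
have fe : free [tuple e] by rewrite seq1_free.
have c1 : coord [tuple e] ord0 e = 1 by apply: (coord_free ord0 ord0 fe).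
have cu x : x - c x *: e \in u.
  have xin : x \in (<[e]> + u)%VS by rewrite addvC full_decomp memvf.
  have := daddv_pi_add dis xin.
  have := memv_pi <[e]>%VS u x; move/vlineP => [a ha].
  have cZ : coord [tuple e] ord0 (a *: e) = a by rewrite linearZ /= c1 mulr1.
  rewrite /c ha cZ.
  by move=> {1}<-; rewrite addrC addKr memv_pi.
exists c; split=> //.
- by move=> a x y; rewrite /c !linearP.
- by apply/esym/eqP; rewrite -subr_eq0; apply/eqP/mult0; rewrite scalerBl scale1r.
- move=> x xu; apply: mult0.
  by rewrite -[_ *: _](subKr x) memvB ?cu.
Qed.

Lemma br_anti x y : br x y = - br y x.
Proof.
have := hbr (x + y); rewrite linearDl !linearDr !hbr /= add0r addr0 => /eqP.
by rewrite addr_eq0 => /eqP.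
Qed.

Variable al : kform L 4.
Hypothesis aal : is_altform al.

(** The action of ad e on al as a derivation, which is minus the Lie derivative. *)
Definition lie_der x y z w :=
  al (vec4 (br e x) y z w) + al (vec4 x (br e y) z w)
  + al (vec4 x y (br e z) w) + al (vec4 x y z (br e w)).

Let S_lin :=
  (fun a t t' y z w => (multilinear_vec4 a t t' 0 y z w aal.1).1.1.1,
   fun a t t' x z w => (multilinear_vec4 a t t' x 0 z w aal.1).1.1.2,
   fun a t t' x y w => (multilinear_vec4 a t t' x y 0 w aal.1).1.2,
   fun a t t' x y z => (multilinear_vec4 a t t' x y z 0 aal.1).2).

Lemma alt4_eq x y z : (al (vec4 x x y z) = 0) * (al (vec4 y x x z) = 0) * (al (vec4 y z x x) = 0).
Proof.
split; [split|].
- exact: (aal.2 _ ord0 (lift ord0 ord0)).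
- exact: (aal.2 _ (lift ord0 ord0) (lift ord0 (lift ord0 ord0))).
- exact: (aal.2 _ (lift ord0 (lift ord0 ord0)) (lift ord0 (lift ord0 (lift ord0 ord0)))).
Qed.

Lemma alt4_swap1 x y z w : al (vec4 x y z w) = - al (vec4 y x z w).
Proof.
apply: (@bilin_alt_anti _ _ (fun x y => al (vec4 x y z w))).
  by split=> a t t' s; rewrite S_lin.
by move=> s; rewrite alt4_eq.
Qed.

Lemma alt4_swap2 x y z w : al (vec4 x y z w) = - al (vec4 x z y w).
Proof.
apply: (@bilin_alt_anti _ _ (fun y z => al (vec4 x y z w))).
  by split=> a t t' s; rewrite S_lin.
by move=> s; rewrite alt4_eq.
Qed.

Lemma alt4_swap3 x y z w : al (vec4 x y z w) = - al (vec4 x y w z).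
Proof.
apply: (@bilin_alt_anti _ _ (fun z w => al (vec4 x y z w))).
  by split=> a t t' s; rewrite S_lin.
by move=> s; rewrite alt4_eq.
Qed.

Lemma alt4_0 x y z : al (vec4 0 x y z) = 0.
Proof. by have := S_lin.1.1.1 (-1) 0 0 x y z; rewrite scaler0 addr0 mulN1r addNr. Qed.

Lemma lie_der_front x y z w : lie_der x y z w =
  al (vec4 (br e x) y z w) - al (vec4 (br e y) x z w) + al (vec4 (br e z) x y w)
  - al (vec4 (br e w) x y z).
Proof.
rewrite /lie_der (alt4_swap1 x) (alt4_swap2 x y) (alt4_swap1 x (br e z)).
rewrite (alt4_swap3 x y z) (alt4_swap2 x y) (alt4_swap1 x (br e w)).
ring.
Qed.

Lemma lie_der_lin a t t' x y z w :
  (lie_der (a *: t + t') y z w = a * lie_der t y z w + lie_der t' y z w) *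
  (lie_der x (a *: t + t') z w = a * lie_der x t z w + lie_der x t' z w) *
  (lie_der x y (a *: t + t') w = a * lie_der x y t w + lie_der x y t' w) *
  (lie_der x y z (a *: t + t') = a * lie_der x y z t + lie_der x y z t').
Proof.
by split; [split; [split|]|]; rewrite /lie_der linearPr !S_lin; ring.
Qed.

Lemma lie_der_alt x y z :
  (lie_der x x y z = 0) * (lie_der y x x z = 0) * (lie_der y z x x = 0).
Proof.
split; [split|]; rewrite /lie_der !alt4_eq.
- by rewrite (alt4_swap1 x); ring.
- by rewrite (alt4_swap2 y x); ring.
- by rewrite (alt4_swap3 y z x); ring.
Qed.

Let B_lin :=
  (fun a t t' y z w => (lie_der_lin a t t' 0 y z w).1.1.1,
   fun a t t' x z w => (lie_der_lin a t t' x 0 z w).1.1.2,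
   fun a t t' x y w => (lie_der_lin a t t' x y 0 w).1.2,
   fun a t t' x y z => (lie_der_lin a t t' x y z 0).2).

Lemma lie_der_swap1 x y z w : lie_der x y z w = - lie_der y x z w.
Proof.
apply: (@bilin_alt_anti _ _ (fun x y => lie_der x y z w)).
  by split=> a t t' s; rewrite B_lin.
by move=> s; rewrite lie_der_alt.
Qed.

Lemma lie_der_swap2 x y z w : lie_der x y z w = - lie_der x z y w.
Proof.
apply: (@bilin_alt_anti _ _ (fun y z => lie_der x y z w)).
  by split=> a t t' s; rewrite B_lin.
by move=> s; rewrite lie_der_alt.
Qed.

Lemma lie_der_swap3 x y z w : lie_der x y z w = - lie_der x y w z.
Proof.
apply: (@bilin_alt_anti _ _ (fun z w => lie_der x y z w)).
  by split=> a t t' s; rewrite B_lin.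
by move=> s; rewrite lie_der_alt.
Qed.

(** The terms with two or more arguments e vanish. *)
Lemma lie_der_expand a b c d x y z w : lie_der x y z w = 0 ->
  lie_der (a *: e + x) (b *: e + y) (c *: e + z) (d *: e + w) =
  a * lie_der e y z w - b * lie_der e x z w + c * lie_der e x y w
  - d * lie_der e x y z.
Proof.
move=> h0.
have q1 p q r : lie_der p e q r = - lie_der e p q r by apply: lie_der_swap1.
have q2 p q r : lie_der p q e r = lie_der e p q r.
  by rewrite lie_der_swap2 q1 opprK.
have q3 p q r : lie_der p q r e = - lie_der e p q r by rewrite lie_der_swap3 q2.
have z1 p q : lie_der e p e q = 0 by rewrite lie_der_swap2 lie_der_alt oppr0.
have z2 p q : lie_der e p q e = 0 by rewrite lie_der_swap3 z1 oppr0.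
have z3 p q : lie_der p e q e = 0 by rewrite lie_der_swap3 lie_der_alt oppr0.
rewrite !B_lin !lie_der_alt !(z1, z2, z3) h0 (q1 x) (q2 x) (q3 x); ring.
Qed.

(** Let c be the functional of [transverse_coord]. As u is Abelian, the bracket is
[x, y] = c x [e, y] - c y [e, x], and therefore the differential of al is
- c ∧ [lie_der]. Since [lie_der] is alternating and c has the kernel u, this
product only depends on the restriction of [lie_der] to u. *)
Lemma closed_iff_lie_der :
  (forall X, ext_d (m := 3) br al X = 0) <->
  (forall x y z w, x \in u -> y \in u -> z \in u -> w \in u -> lie_der x y z w = 0).
Proof.
have [c [cl cu ce c0]] := transverse_coord.
have brE x y : br x y = c x *: br e y + (- c y *: br e x + 0).
  have h x' : x' = c x' *: e + (x' - c x' *: e) by rewrite addrC subrK.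
  have brD z : br e z = br e (z - c z *: e).
    by rewrite {1}(h z) linearPr hbr scaler0 add0r.
  rewrite {1}(h x) {1}(h y) addr0 linearPl !linearPr hbr.
  rewrite (hu.2 _ _ (cu x) (cu y)) scaler0 add0r addr0 (br_anti _ e).
  by rewrite -!brD scalerN scaleNr.
have dE x y z w t : ext_d (m := 3) br al (vec5 x y z w t) =
    - (c x * lie_der y z w t) + c y * lie_der x z w t - c z * lie_der x y w t
    + c w * lie_der x y z t - c t * lie_der x y z w.
  rewrite ext_d_vec5 (brE x y) (brE x z) (brE x w) (brE x t) (brE y z) (brE y w)
    (brE y t) (brE z w) (brE z t) (brE w t).
  rewrite !S_lin !alt4_0 !lie_der_front; ring.
split=> [h x y z w xu yu zu wu|h X].
  have := h (vec5 e x y z w).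
  rewrite dE ce !c0 // !mul0r !(addr0, subr0) mul1r => /eqP.
  by rewrite oppr_eq0 => /eqP.
have [x [y [z [w [t ->]]]]] := vec5_eta X; rewrite dE.
have B1 x1 y1 z1 w1 : lie_der x1 y1 z1 w1 =
    c x1 * lie_der e (y1 - c y1 *: e) (z1 - c z1 *: e) (w1 - c w1 *: e)
  - c y1 * lie_der e (x1 - c x1 *: e) (z1 - c z1 *: e) (w1 - c w1 *: e)
  + c z1 * lie_der e (x1 - c x1 *: e) (y1 - c y1 *: e) (w1 - c w1 *: e)
  - c w1 * lie_der e (x1 - c x1 *: e) (y1 - c y1 *: e) (z1 - c z1 *: e).
  have hh x' : x' = c x' *: e + (x' - c x' *: e) by rewrite addrC subrK.
  by rewrite {1}(hh x1) {1}(hh y1) {1}(hh z1) {1}(hh w1) lie_der_expand // h.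
rewrite (B1 y z w t) (B1 x z w t) (B1 x y w t) (B1 x y z t) (B1 x y z w); ring.
Qed.

End ExtD.

(** * Cocalibrated structures and preserved two-forms *)

(** In an adapted basis, E_7 ⌟ phi = E^12 + E^34 + E^56. *)
Lemma omega_check : all7 (fun i => all7 (fun j => (i == 6) || (j == 6) ||
  (phi_lookup 6 i j == if odd i then - (i == j.+1)%:Z else (j == i.+1)%:Z))).
Proof. by vm_compute. Qed.

Section AdOn.
Variables (F : numFieldType) (L : vectType F) (br : {bilinear L -> L -> L}).
Variables (u : {vspace L}) (e : L).
Hypothesis hbr : forall x, br x x = 0.
Hypothesis hu : abelian_ideal br u.
Hypothesis hcodim : (\dim u).+1 = \dim {:L}.
Hypothesis he : e \notin u.
Hypothesis hdim : \dim {:L} = 7%N.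

Lemma ad_onE (x : subvs_of u) : vsval (ad_on br e u x) = br e (vsval x).
Proof.
rewrite /ad_on linfun_linearE ?vsprojK // => [|a y z]; last by rewrite !linearP.
by apply: hu.1; apply: subvsP.
Qed.

(** The equations g n b_i = 0 for a basis b of u are one fewer than the dimension. *)
Lemma exists_normal (g : L -> L -> F) : bilin g ->
  exists2 n : L, n != 0 & forall y, y \in u -> g n y = 0.
Proof.
move=> bg; pose h x : 'rV[F]_(\dim u) := \row_i g x (vbasis u)`_i.
have hl a x y : h (a *: x + y) = a *: h x + h y.
  by apply/rowP => i; rewrite !mxE bg.1.
pose l := linfun h; have lE := linfun_linearE hl.
have kn0 : lker l != 0%VS.
  apply/eqP => k0; have := limg_ker_dim l fullv.
  rewrite k0 capv0 dimv0 add0n => d; have := dimvS (subvf (limg l)).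
  by rewrite d -hcodim [X in (_ < X)%N]dimvf /dim /= mul1n ltnn.
exists (vpick (lker l)); first by rewrite vpick0.
move=> y yu; have := memv_pick (lker l); rewrite memv_ker lE => /eqP h0.
rewrite (coord_vbasis yu) bilin_sumr // big1 // => i _.
by have /rowP /(_ i) := h0; rewrite !mxE => ->; rewrite mulr0.
Qed.

(** For a normal vector n of u, the preserved two-form is the restriction f of n ⌟ phi.
By [phi_square] the restriction of star_phi is proportional to f ∧ f, so by
[closed_iff_lie_der] the action of ad e on f gives a two-form whose product with f
vanishes, and [sympl_wedge_inj] applies. *)
Lemma cocalibrated_preserves_sympl :
  (exists (phi : kform L 3) (vol : kform L 7) (g : {biscalar L}) (star_phi : kform L 4),
     cocalibrated_G2C_structure br phi vol g star_phi /\ nondegenerate_on g u) ->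
  preserves_sympl (ad_on br e u).
Proof.
move=> [phi [vol [g [star [[[E ad] ind hodge closed] nd]]]]].
have bE : basis_of {:L} E by case: ad.
have gE := induced_metric_dot ad ind.
have starE := hodge_star_values ad gE hodge.
have aS : is_altform star := hodge.1.
have [lie _] := closed_iff_lie_der hbr hu hcodim he aS.
have {}lie := lie closed.
have bg := biscalar_bilin g.
have [n n0 gn] := exists_normal bg.
have nu : n \notin u.
  by apply: contraNN n0 => nin; apply/eqP/nd.
have full := full_decomp hcodim nu.
have gnn : g n n != 0.
  apply: contraNneq n0 => gnn; apply/eqP/(dot_nondeg bE) => y.
  have : y \in (u + <[n]>)%VS by rewrite full memvf.
  case/memv_addP => y1 y1u [y2 /vlineP [a ->] ->].
  by rewrite -gE (bilinDr bg) (bilinZr bg) gn // gnn mulr0 addr0.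
have aphi := adapted_phi_alt ad.
have bphi : bilin (fun x y => phi (vec3 n x y)).
  by split=> a x y z; rewrite ?(multilinear_vec3 a x y n 0 z aphi.1).1.2
    ?(multilinear_vec3 a x y n z 0 aphi.1).2.
have phixx x : phi (vec3 n x x) = 0.
  exact: (aphi.2 _ (lift ord0 ord0) (lift ord0 (lift ord0 ord0))).
have phinx x : phi (vec3 n x n) = 0.
  exact: (aphi.2 _ ord0 (lift ord0 (lift ord0 ord0))).
pose f (x y : subvs_of u) := phi (vec3 n (vsval x) (vsval y)).
have bf : bilin f.
  by split=> a x y z; rewrite /f linearP ?bphi.1 ?bphi.2.
have fxx x : f x x = 0 by apply: phixx.
have [w wE] := bilin_biscalar bf.
have fnd x : (forall y, f x y = 0) -> x = 0.
  move=> fx; apply: val_inj; apply: nd; first exact: subvsP.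
  move=> y yu; have P0 z : phi (vec3 n (vsval x) z) = 0.
    have : z \in (u + <[n]>)%VS by rewrite full memvf.
    case/memv_addP => y1 y1u [y2 /vlineP [a ->] ->].
    rewrite (bilinDr bphi) (bilinZr bphi) phinx mulr0 addr0.
    by have := fx (vsproj u y1); rewrite /f vsprojK.
  have := phi_cross_norm bE ad n (vsval x) y.
  rewrite big1 => [|k _]; last by rewrite P0 mul0r.
  rewrite -!gE (gn y) // mulr0 subr0 => /esym /eqP.
  by rewrite mulf_eq0 (negPf gnn) => /eqP.
have nw : nondegenerate_2form w.
  split=> [x|x _ h]; first by rewrite wE.
  by apply: fnd => y; rewrite -wE h ?memvf.
exists w => //; have [s bs gs] := sympl_basis nw.
have s6 : size s = 6%N.
  rewrite -(size_basis (X := in_tuple s) bs) dimvf /dim /=.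
  by apply/succn_inj; rewrite hcodim.
pose A := ad_on br e u.
pose al x y := f (A x) y + f x (A y).
have bal : bilin al.
  split=> a x y z; rewrite /al linearP; rewrite ?bf.1 ?bf.2; ring.
have fanti := bilin_alt_anti bf fxx.
have gs' : sympl_gram f s.
  by case: gs => ev gs; split=> // i j li lj; rewrite -wE gs.
move=> x y; rewrite !wE -/(al x y).
apply: (sympl_wedge_inj bf bal _ bs gs' s6) => [z|].
  by rewrite /al [f z _]fanti subrr.
move=> {x y} x y z t.
have := lie _ _ _ _ (subvsP x) (subvsP y) (subvsP z) (subvsP t).
move/(congr1 (fun a => g n n * a)); rewrite mulr0 => h.
have g0 v : dot E n (vsval (v : subvs_of u)) = 0 by rewrite -gE gn ?subvsP.
have sq a b c d : g n n * star (vec4 (vsval a) (vsval b) (vsval c) (vsval d)) =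
   f a b * f c d - f a c * f b d + f a d * f b c.
  by rewrite gE -(phi_square bE ad aS starE (g0 a) (g0 b) (g0 c) (g0 d)).
rewrite /lie_der -!ad_onE !mulrDr !sq -/A in h.
by apply: (etrans _ h); rewrite /al; ring.
Qed.

Lemma adapted_of_basis (E : 7.-tuple L) : basis_of {:L} E ->
  adapted_basis (eval_formal E 3 formal_phi) (nat_form E 7 (iota 0 7)) E.
Proof.
move=> bE; split=> // v; rewrite !cowedge_nat_form // /eval_formal !big_cons big_nil /=.
by rewrite !mulrN1z !mulN1r !mul1r addr0 !addrA.
Qed.

(** A symplectic basis of the preserved two-form, followed by e, is taken as an adapted
basis. Then e is a unit normal vector of u, and e ⌟ phi restricts to the preserved
two-form. By [phi_square] the restriction of the Hodge dual is built from this
two-form alone, so it is annihilated by ad e. *)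
Lemma preserves_sympl_cocalibrated : preserves_sympl (ad_on br e u) ->
  exists (phi : kform L 3) (vol : kform L 7) (g : {biscalar L}) (star_phi : kform L 4),
     cocalibrated_G2C_structure br phi vol g star_phi /\ nondegenerate_on g u.
Proof.
move=> [w nw wA]; have [s bs gs] := sympl_basis nw.
have s6 : size s = 6%N.
  rewrite -(size_basis (X := in_tuple s) bs) dimvf /dim /=.
  by apply/succn_inj; rewrite hcodim.
have sE : size (rcons (map vsval s) e) == 7%N by rewrite size_rcons size_map s6.
pose E := Tuple sE.
have E6 : E`_6 = e by rewrite /= nth_rcons size_map s6.
have Elt i : (i < 6)%N -> E`_i = vsval s`_i.
  by move=> li; rewrite /= nth_rcons size_map s6 li (nth_map 0) ?s6.
have uE x : x \in u -> exists c : 'I_6 -> F, x = \sum_i c i *: E`_i.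
  move=> xu; exists (fun i => coord (in_tuple s) (cast_ord (esym s6) i) (vsproj u x)).
  rewrite -{1}(vsprojK xu) {1}(coord_basis (X := in_tuple s) bs (memvf (vsproj u x))).
  rewrite linear_sum /= (reindex (cast_ord (esym s6))) /=; last first.
    by exists (cast_ord s6) => i _; rewrite ?cast_ordK ?cast_ordKV.
  by apply: eq_bigr => i _; rewrite Elt.
have bE : basis_of {:L} E.
  rewrite basisEdim size_tuple hdim leqnn andbT -(full_decomp hcodim he).
  have eE : e \in <<E>>%VS by rewrite -{1}E6 memv_span ?mem_nth ?size_tuple.
  rewrite subv_add -memvE eE andbT.
  apply/subvP => x /uE [c ->]; apply: memv_suml => i _.
  by rewrite memvZ // memv_span // mem_nth // size_tuple ltnS ltnW.
have ad := adapted_of_basis bE.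
have bdot : bilin (dot E) by split=> a x y z; rewrite ?dot_linl ?dot_linr.
have [g gE] := bilin_biscalar bdot.
have hodge := hodge_star_formal ad gE.
have starE := hodge_star_values ad gE hodge.
have due x : x \in u -> dot E e x = 0.
  move=> /uE [c ->]; rewrite (bilin_sumr bdot) big1 // => i _.
  rewrite -E6 (dot_basis bE) // ?(ltn_trans (ltn_ord i)) //.
  by rewrite eq_sym ltn_eqF ?mulr0.
exists (eval_formal E 3 formal_phi), (nat_form E 7 (iota 0 7)), g,
  (eval_formal E 4 formal_star); split; last first.
  move=> x xu h; apply: (dot_nondeg bE) => y.
  have : y \in (u + <[e]>)%VS by rewrite (full_decomp hcodim he) memvf.
  case/memv_addP => y1 y1u [y2 /vlineP [a ->] ->].
  by rewrite (bilinDr bdot) (bilinZr bdot) -gE h // dotC due // mulr0 addr0.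
split; first by exists E.
- by move=> x y v; rewrite (metric_formula ad) gE.
- exact: hodge.
have aS : is_altform (eval_formal E 4 formal_star) := hodge.1.
apply/(closed_iff_lie_der hbr hu hcodim he aS) => x y z t xu yu zu tu.
have aphi := adapted_phi_alt ad.
pose f x y := eval_formal E 3 formal_phi (vec3 e x y).
have bf : bilin f.
  by split=> a x' y' z'; rewrite /f ?(multilinear_vec3 a x' y' e 0 z' aphi.1).1.2
    ?(multilinear_vec3 a x' y' e z' 0 aphi.1).2.
have bw := biscalar_bilin w.
have fw (a b : subvs_of u) : f (vsval a) (vsval b) = w a b.
  have vs (c : subvs_of u) : vsval c = \sum_i coord (in_tuple s) i c *: vsval s`_i.
    by rewrite {1}(coord_basis (X := in_tuple s) bs (memvf c)) linear_sum.
  rewrite (vs a) (vs b) (bilin_suml bf).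
  rewrite [in RHS](coord_basis (X := in_tuple s) bs (memvf a)).
  rewrite [in RHS](coord_basis (X := in_tuple s) bs (memvf b)).
  rewrite (bilin_suml bw); apply: eq_bigr => i _; congr (_ * _).
  rewrite (bilin_sumr bw) (bilin_sumr bf); apply: eq_bigr => j _; congr (_ * _).
  have li : (i < 6)%N by rewrite -s6.
  have lj : (j < 6)%N by rewrite -s6.
  rewrite gs.2 // -!Elt // /f -{1}E6 (phi_basis bE ad) // ?(ltn_trans li) ?(ltn_trans lj) //.
  have := all7P (all7P omega_check (ltn_trans li (ltnSn 6))) (ltn_trans lj (ltnSn 6)).
  rewrite (ltn_eqF li) (ltn_eqF lj) /= => /eqP ->; rewrite /std_sympl.
  by case: ifP => _; rewrite ?mulrNz; case: eqP.
have fA a b : a \in u -> b \in u -> f (br e a) b + f a (br e b) = 0.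
  move=> au bu; have := wA (vsproj u a) (vsproj u b).
  by rewrite -!fw !ad_onE !vsprojK.
have sq a b c d : a \in u -> b \in u -> c \in u -> d \in u ->
    eval_formal E 4 formal_star (vec4 a b c d) =
    f a b * f c d - f a c * f b d + f a d * f b c.
  move=> au bu cu du; rewrite /f.
  rewrite (phi_square bE ad aS starE (due _ au) (due _ bu) (due _ cu) (due _ du)).
  by rewrite -{1 2}E6 (dot_basis bE) // mul1r.
have be a : a \in u -> br e a \in u by move=> au; apply: hu.1.
rewrite /lie_der !sq ?be //.
have fA' a b : a \in u -> b \in u -> f a (br e b) = - f (br e a) b.
  by move=> au bu; apply/eqP; rewrite -addr_eq0 addrC fA.
rewrite (fA' x y) // (fA' x z) // (fA' x t) // (fA' y z) // (fA' y t) // (fA' z t) //.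
ring.
Qed.

End AdOn.

(** * Existence of Jordan chains *)

Section JordanExistence.
Variables (F : numClosedFieldType) (U : vectType F) (A : 'End(U)).

Definition shift (a : F) (x : U) : U := A x - a *: x.

(** A triple (x, (m, a)) encodes the chain (A - a)^(m - 1) x, ..., (A - a) x, x.
Linear independence is not part of the data: whenever it is needed it follows by
comparing [chains_size] with a dimension. *)
Definition is_chain (b : U * (nat * F)) :=
  (0 < b.2.1)%N /\ iter b.2.1 (shift b.2.2) b.1 = 0.

Definition chain_span (b : U * (nat * F)) : {vspace U} :=
  (\sum_(p < b.2.1) <[iter p (shift b.2.2) b.1]>)%VS.

Definition chains_span (c : seq (U * (nat * F))) : {vspace U} :=
  (\sum_(b <- c) chain_span b)%VS.

Definition chains_size (c : seq (U * (nat * F))) : nat := \sum_(b <- c) b.2.1.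

Definition stable (V : {vspace U}) := forall x, x \in V -> A x \in V.

Lemma shift_lin a c x y : shift a (c *: x + y) = c *: shift a x + shift a y.
Proof.
rewrite /shift linearP scalerDr scalerBr !scalerA (mulrC a) opprD.
by rewrite -!addrA; congr (_ + _); rewrite addrCA.
Qed.

Lemma shift_stable V a x : stable V -> x \in V -> shift a x \in V.
Proof. by move=> sV xV; rewrite memvB ?sV ?memvZ. Qed.

Lemma iter_shift_stable V a p x : stable V -> x \in V -> iter p (shift a) x \in V.
Proof. by move=> sV xV; elim: p => //= p IH; apply: shift_stable. Qed.

Lemma chain_span_stable V b : stable V -> b.1 \in V -> (chain_span b <= V)%VS.
Proof.
by move=> sV bV; apply/subv_sumP => p _; rewrite -memvE iter_shift_stable.
Qed.

Lemma mem_chain b p : (p < b.2.1)%N -> iter p (shift b.2.2) b.1 \in chain_span b.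
Proof.
move=> lp; rewrite memvE /chain_span (bigD1 (Ordinal lp)) //=; exact: addvSl.
Qed.

Lemma dim_chain_span b : (\dim (chain_span b) <= b.2.1)%N.
Proof.
apply: leq_trans (dimv_leq_sum _ _ _) _.
rewrite -[X in (_ <= X)%N]card_ord -sum1_card leq_sum // => p _.
by rewrite dim_vline leq_b1.
Qed.

(** The matrix of A on V acts on rows of coordinates, so an eigenvector of the matrix
gives one of A. *)
Lemma eigenvector_exists V : stable V -> V != 0%VS ->
  exists a x, [/\ x \in V, x != 0 & shift a x = 0].
Proof.
move=> sV Vn0; set b := vbasis V.
pose M := \matrix_(i < \dim V, j < \dim V) coord b j (A b`_i).
have d0 : (0 < \dim V)%N by rewrite lt0n dimv_eq0.
have /closed_rootP [a ra] : size (char_poly M) != 1%N.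
  by rewrite size_char_poly; case: (\dim V) d0.
have /eigenvalueP [v vM vn0] : eigenvalue M a by rewrite eigenvalue_root_char.
exists a, (\sum_i v 0 i *: b`_i).
have bV i : (i < \dim V)%N -> b`_i \in V.
  by move=> li; rewrite vbasis_mem // mem_nth ?size_tuple.
split.
- by apply: memv_suml => i _; rewrite memvZ ?bV.
- have /freeP fb := basis_free (vbasisP V).
  apply: contraNneq vn0 => /fb h.
  by apply/eqP/rowP => i; rewrite h mxE.
- apply/eqP; rewrite subr_eq0; apply/eqP.
  rewrite linear_sum scaler_sumr /=.
  transitivity (\sum_i \sum_j (v 0 i * M i j) *: b`_j).
    apply: eq_bigr => i _; rewrite linearZ /= {1}(coord_vbasis (sV _ (bV i (ltn_ord i)))).
    by rewrite scaler_sumr; apply: eq_bigr => j _; rewrite scalerA mxE.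
  rewrite exchange_big /=; apply: eq_bigr => j _; rewrite -scaler_suml scalerA.
  by have /rowP /(_ j) := vM; rewrite !mxE => ->.
Qed.

Section Step.
Variables (V : {vspace U}) (a : F).
Hypothesis sV : stable V.

Let B : 'End(U) := linfun (shift a).
Let BE x : B x = shift a x. Proof. exact: (linfun_linearE (shift_lin a)). Qed.
Let V' := (B @: V)%VS.

(** A - a is invertible on the span of a chain for another eigenvalue: the chain
vector e_p is (c - a)^-1 ((A - a) e_p - e_(p+1)), and one descends from the last
vector, which is the eigenvector. *)
Lemma chain_image_other b : is_chain b -> b.2.2 != a ->
  (chain_span b <= B @: chain_span b)%VS.
Proof.
case: b => x [m c] [/= m0 xm] nca; apply/subv_sumP => p _ /=; rewrite -memvE.
move: (p : nat) => {}p; have [k] := ubnP (m - p); elim: k p => // k IH p lt.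
have [lp|] := ltnP p m; last first.
  move=> le; rewrite -(subnK le) iterD xm.
  suff -> : iter (p - m) (shift c) 0 = 0 by apply: mem0v.
  elim: (p - m)%N => //= q ->.
  by have := shift_lin c (-1) 0 0; rewrite scaler0 addr0 scaleN1r addNr.
have h : shift c (iter p (shift c) x) \in (B @: chain_span (x, (m, c)))%VS.
  by apply: (IH p.+1); lia.
have e : iter p (shift c) x =
    (c - a)^-1 *: (B (iter p (shift c) x) - shift c (iter p (shift c) x)).
  move: (iter p _ x) => y; have -> : B y - shift c y = (c - a) *: y.
    by rewrite BE /shift scalerBl opprB addrC addrA subrK.
  by rewrite scalerA mulVf ?scale1r // subr_eq0.
rewrite e memvZ // memvB // memv_img //.
exact: (@mem_chain (x, (m, c))).
Qed.

(** A chain for a is prolonged by a preimage of its generator, the others are kept. *)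
Lemma chains_extend c : (forall b, b \in c -> is_chain b /\ b.1 \in V') ->
  exists c1, [/\ forall b, b \in c1 -> is_chain b /\ b.1 \in V,
    chains_size c1 = (chains_size c + count (fun b => b.2.2 == a) c)%N,
    (chains_span c <= chains_span c1)%VS & (chains_span c <= B @: chains_span c1)%VS].
Proof.
have V'V : (V' <= V)%VS.
  by apply/subvP => x /memv_imgP [y yV ->]; rewrite BE shift_stable.
elim: c => [|b c IH] H.
  by exists [::]; split; rewrite // /chains_size /chains_span ?big_nil ?sub0v.
have [|c1 [h1 h2 h3 h4]] := IH; first by move=> b' b'c; apply: H; rewrite inE b'c orbT.
have [cb bV] := H b (mem_head _ _).
suff [b1 [k1 k1' k2 k3 k4]] : exists b1, [/\ is_chain b1, b1.1 \in V,
    b1.2.1 = (b.2.1 + (b.2.2 == a))%N, (chain_span b <= chain_span b1)%VS &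
    (chain_span b <= B @: chain_span b1)%VS].
  exists (b1 :: c1); split.
  - by move=> b'; rewrite inE => /orP [/eqP -> | /h1].
  - by rewrite /chains_size !big_cons -/(chains_size c1) h2 k2 addnACA.
  - by rewrite /chains_span !big_cons addvS.
  - by rewrite /chains_span !big_cons limgD addvS.
have [ea|na] := eqVneq b.2.2 a; last first.
  exists b; split=> //; rewrite ?addn0 //; first exact: (subvP V'V).
  exact: chain_image_other.
case: b ea cb bV {H} => x [m c0] /= -> [/= m0 xm] /memv_imgP [y yV xy].
have yx : shift a y = x by rewrite xy BE.
exists (y, (m.+1, a)); split=> //=.
- by split=> //; rewrite [LHS]iterSr yx.
- by rewrite addn1.
- apply/subv_sumP => p _ /=; rewrite -memvE -yx -iterSr.
  by apply: (@mem_chain (y, (m.+1, a))); rewrite /= ltnS.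
apply/subv_sumP => p _ /=; rewrite -memvE -yx -iterSr /= -BE memv_img //.
by apply: (@mem_chain (y, (m.+1, a))); rewrite /= ltnS ltnW.
Qed.

(** Under A - a every chain for a loses its eigenvector. *)
Lemma chains_image_dim c : (forall b, b \in c -> is_chain b) ->
  (\dim (B @: chains_span c) + count (fun b => b.2.2 == a) c <= chains_size c)%N.
Proof.
elim: c => [|b c IH] H.
  by rewrite /chains_span /chains_size !big_nil limg0 dimv0.
have {}IH := IH (fun b' bc => H b' (@mem_behead _ (b :: c) b' bc)).
have cb := H b (mem_head _ _).
rewrite /chains_span /chains_size !big_cons -/(chains_span c) -/(chains_size c) limgD /=.
have h1 : (\dim (B @: chain_span b) + (b.2.2 == a) <= b.2.1)%N.
  have [ea|_] := eqVneq; last first.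
    rewrite addn0; apply: leq_trans (dim_chain_span b).
    by rewrite -(limg_ker_dim B (chain_span b)) leq_addl.
  case: b ea cb {H} => x [m c0] /= -> [/= m0 xm].
  rewrite addn1 -(prednK m0) ltnS.
  have sub : (B @: chain_span (x, (m.-1.+1, a)) <= chain_span (shift a x, (m.-1, a)))%VS.
    rewrite /chain_span limg_sum; apply/subv_sumP => p _ /=; rewrite limg_line -memvE BE.
    rewrite -iterS iterSr; have [lp|le] := ltnP p m.-1.
      exact: (@mem_chain (shift a x, (m.-1, a))).
    have -> : (p : nat) = m.-1 by apply/eqP; rewrite eqn_leq le -ltnS ltn_ord.
    by rewrite -iterSr prednK // xm mem0v.
  exact: leq_trans (dimvS sub) (dim_chain_span (_, (m.-1, a))).
have h2 := (dimv_add_leqif (B @: chain_span b) (B @: chains_span c)).1.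
by apply: leq_trans (leq_add h1 IH); rewrite addnACA leq_add2r.
Qed.

End Step.

(** Filippov's induction. For an eigenvalue a of A on V, prolong the chains for a in a
Jordan basis of V' = (A - a) V, and add a basis of a complement of V' in the
kernel of A - a as chains of length one. The new chains span V, and their total
length is at most dim V because, by [chains_image_dim], V' contains at least as
many independent eigenvectors for a as it has chains for a. *)
Lemma jordan_chains (V : {vspace U}) : stable V ->
  exists c, [/\ forall b, b \in c -> is_chain b /\ b.1 \in V,
    chains_span c = V & (chains_size c <= \dim V)%N].
Proof.
have [m] := ubnP (\dim V); elim: m V => // m IH V lt_m sV.
have [V0|Vn0] := eqVneq V 0%VS.
  by exists [::]; split; rewrite // /chains_span /chains_size !big_nil ?V0.
have [a [x0 [x0V x0n0 ax0]]] := eigenvector_exists sV Vn0.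
pose B : 'End(U) := linfun (shift a).
have BE x : B x = shift a x by exact: (linfun_linearE (shift_lin a)).
pose V' := (B @: V)%VS.
have V'V : (V' <= V)%VS.
  by apply/subvP => x /memv_imgP [y yV ->]; rewrite BE shift_stable.
have dV := limg_ker_dim B V.
have k0 : (0 < \dim (V :&: lker B))%N.
  rewrite lt0n dimv_eq0; apply: contraNneq x0n0 => K0.
  by rewrite -memv0 -K0 memv_cap x0V memv_ker BE ax0 /=.
have ltV' : (\dim V' < m)%N by move: lt_m; rewrite -dV /V'; lia.
have sV' : stable V'.
  move=> x /memv_imgP [y yV ->]; rewrite BE.
  have -> : A (shift a y) = B (A y).
    by rewrite BE /shift linearB linearZ.
  by rewrite memv_img ?sV.
have [c' [hc' spc' szc']] := IH V' ltV' sV'.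
have [c1 [h1 h2 h3 h4]] := chains_extend sV hc'.
have cd := chains_image_dim a (fun b bc => (hc' b bc).1); rewrite -/B in h4 cd.
rewrite spc' in h3 h4 cd.
pose K := (V :&: lker B)%VS; pose Z := (K :\: V')%VS.
(* Eigenvectors that complete those which V' contains already. *)
pose c2 : seq (U * (nat * F)) := [seq (z, (1%N, a)) | z <- vbasis Z].
have ZK : (Z <= K)%VS := diffvSl K V'.
have sp2 : chains_span c2 = Z.
  rewrite /chains_span /c2 big_map -[RHS](span_basis (vbasisP Z)) span_def.
  by apply: eq_bigr => z _; rewrite /chain_span big_ord1.
have sz2 : chains_size c2 = \dim Z.
  by rewrite /chains_size /c2 big_map sum1_size size_tuple.
have hZ z : z \in Z -> z \in V /\ shift a z = 0.
  by move=> /(subvP ZK); rewrite memv_cap memv_ker BE => /andP [-> /eqP].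
have hc b : b \in c1 ++ c2 -> is_chain b /\ b.1 \in V.
  rewrite mem_cat => /orP [/h1 // | /mapP [z zb ->]] /=.
  by have [zV zk] := hZ z (vbasis_mem zb).
have cat_sp : chains_span (c1 ++ c2) = (chains_span c1 + Z)%VS.
  by rewrite -sp2 /chains_span big_cat.
have sub1 : (chains_span c1 <= V)%VS.
  rewrite /chains_span big_seq.
  elim/big_ind: _ => [|X Y hX hY|b /h1 [_ bV]]; first exact: sub0v.
    by rewrite subv_add hX.
  exact: chain_span_stable.
exists (c1 ++ c2); split=> //.
  apply/eqP; rewrite eqEsubv cat_sp subv_add sub1 /=; apply/andP; split.
    by apply/subvP => z /hZ [].
  apply/subvP => v vV.
  have /(subvP h4) /memv_imgP [w wsp Bvw] : B v \in V' by rewrite memv_img.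
  have wV := subvP sub1 _ wsp.
  have : v - w \in K.
    by rewrite memv_cap memvB // memv_ker linearB /= Bvw subrr eqxx.
  rewrite -(addv_diff_cap K V') => /memv_addP [z zZ [t /memv_capP [_ tV'] e]].
  rewrite -(subrK w v) e -addrA addrC; apply: memv_add => //.
  by apply: memvD => //; apply: (subvP h3).
rewrite /chains_size big_cat /= -!/(chains_size _) h2 sz2.
have := dimv_cap_compl K V'; rewrite -/Z.
have -> : \dim (K :&: V') = \dim (V' :&: lker B).
  by congr (\dim _); rewrite /K -capvA (capvC (lker B)) capvA (capv_idPr V'V).
have := limg_ker_dim B V'; rewrite -dV -/V' -/K.
lia.
Qed.

End JordanExistence.

(** * Jordan matrices *)

Section JordanIndex.
Variables (F : fieldType) (s : seq (nat * F)).
Local Notation dim_s := (\sum_i block_size (s := s) i)%N.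

(** The j-th basis vector of a Jordan basis has position [pos j] in the block [blk j].
As [pos j] is a natural number, positions in different blocks can be compared
without casts. *)
Definition blk (j : 'I_dim_s) : 'I_(size s) := tagnat.sig1 j.
Definition pos (j : 'I_dim_s) : nat := tagnat.sig2 j.
Definition eigv (i : 'I_(size s)) : F := (tnth (in_tuple s) i).2.

Lemma pos_lt j : (pos j < block_size (blk j))%N.
Proof. exact: ltn_ord. Qed.

Lemma blk_pos_ex (i : 'I_(size s)) p : (p < block_size i)%N ->
  exists j, blk j = i /\ pos j = p.
Proof.
move=> lp; exists (tagnat.Rank i (Ordinal lp)); split.
  exact: tagnat.Rank1K.
by rewrite /pos tagnat.Rank2K.
Qed.

Lemma blk_pos_inj j k : blk j = blk k -> pos j = pos k -> j = k.
Proof.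
move=> eb ep; rewrite -[j]tagnat.sig2K -[k]tagnat.sig2K.
by apply/val_inj/eqP; rewrite tagnat.eq_Rank; apply/andP; split; apply/eqP.
Qed.

Lemma jordan_mxE j k : jordan_mx s j k =
  (blk j == blk k)%:R * (eigv (blk k) *+ (pos j == pos k) + ((pos j).+1 == pos k)%:R).
Proof.
rewrite /jordan_mx /mxdiag mxE -/(blk j) -/(blk k) /pos.
move: (tagnat.sig2 j) (tagnat.sig2 k); rewrite -/(blk j) -/(blk k).
case: (eqVneq (blk j) (blk k)) => [-> p q|_ p q]; last by rewrite mul0r mxE.
by rewrite conform_mx_id mxE mul1r.
Qed.

Lemma jordan_col (U : vectType F) (X : dim_s.-tuple U) k :
  \sum_j jordan_mx s j k *: X`_j =
  eigv (blk k) *: X`_k +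
  (if [pick j | (blk j == blk k) && ((pos j).+1 == pos k)] is Some j then X`_j else 0).
Proof.
rewrite (bigD1 k) //= jordan_mxE !eqxx mul1r mulr1n.
rewrite (negPf (_ : (pos k).+1 != pos k)) ?addr0; last first.
  by rewrite gtn_eqF.
congr (_ + _); case: pickP => [j /andP [/eqP eb /eqP ep]|none].
  have jk : j != k by apply: contraTneq (leqnn (pos k)) => jk; rewrite -{1}ep jk ltnn.
  rewrite (bigD1 j) //= jordan_mxE eb eqxx ep eqxx mul1r -ep ltn_eqF // mulr0n add0r scale1r.
  rewrite [X in _ + X]big1 ?addr0 // => l /andP [lk lj]; rewrite jordan_mxE.
  case: (eqVneq (blk l) (blk k)) => [el|_]; last by rewrite mul0r scale0r.
  case: (eqVneq (pos l) (pos k)) => [pl|_].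
    by case/eqP: lk; apply: blk_pos_inj.
  case: eqP => [pl|_]; last by rewrite mulr0n addr0 mulr0 scale0r.
  by case/eqP: lj; apply: blk_pos_inj; [rewrite el|apply/succn_inj; rewrite pl ep].
apply: big1 => l lk; rewrite jordan_mxE.
case: (eqVneq (blk l) (blk k)) => [el|_]; last by rewrite mul0r scale0r.
case: (eqVneq (pos l) (pos k)) => [pl|_].
  by case/eqP: lk; apply: blk_pos_inj.
have := none l; rewrite el eqxx /= => ->.
by rewrite mulr0n addr0 mulr0 scale0r.
Qed.

End JordanIndex.

Section JordanForm.
Variables (F : numClosedFieldType) (U : vectType F) (A : 'End(U)).

(** The j-th basis vector is the chain vector with exponent m - 1 - [pos j], since a
Jordan block starts with the eigenvector. *)
Lemma jordan_form_exists : exists s, jordan_normal_form A s.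
Proof.
have aux (q m : nat) : (q < m)%N -> (m.-1 - q < m)%N /\ (m.-1 - (m.-1 - q) = q)%N.
  by lia.
have [|c [hc spc szc]] := @jordan_chains F U A fullv; first by move=> x _; apply: memvf.
pose s := [seq b.2 | b <- c]; exists s.
pose b0 : U * (nat * F) := (0, (0%N, 0)).
have lt_c (i : 'I_(size s)) : (i < size c)%N.
  by rewrite -[X in (_ < X)%N](size_map (fun b => b.2) c) ltn_ord.
have sE (i : 'I_(size s)) : tnth (in_tuple s) i = (nth b0 c i).2.
  by rewrite (tnth_nth (0%N, 0)) /= (nth_map b0) ?lt_c.
have inc (i : 'I_(size s)) : nth b0 c i \in c by rewrite mem_nth ?lt_c.
split.
  by apply/allP => p /mapP [b bc ->]; case: (hc _ bc) => -[].
pose x (j : 'I_(\sum_i block_size (s := s) i)) :=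
  iter ((block_size (blk j)).-1 - pos j) (shift A (eigv (blk j))) (nth b0 c (blk j)).1.
exists [tuple x j | j < (\sum_i block_size (s := s) i)%N].
  rewrite basisEdim size_tuple; apply/andP; split; last first.
    apply: leq_trans szc; rewrite /chains_size -(big_map (fun b => b.2) xpredT (fun p => p.1)).
    by rewrite -/s (big_tnth _ _ s).
  rewrite -spc; rewrite /chains_span big_seq.
  elim/big_ind: _ => [|X Y hX hY|b bc]; first exact: sub0v.
    by rewrite subv_add hX.
  apply/subv_sumP => p _; rewrite -memvE.
  have lb : (index b c < size s)%N by rewrite size_map index_mem.
  have eb : nth b0 c (Ordinal lb) = b by rewrite nth_index.
  have bs : block_size (Ordinal lb) = b.2.1 by rewrite /block_size sE eb.
  have lt : (b.2.1.-1 - p < block_size (Ordinal lb))%N.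
    by rewrite bs; case: (aux _ _ (ltn_ord p)).
  have [j [jb jp]] := blk_pos_ex lt.
  have <- : x j = iter p (shift A b.2.2) b.1.
    rewrite /x jb jp bs /eigv sE eb; congr (iter _ _ _).
    by case: (aux _ _ (ltn_ord p)).
  by apply: memv_span; apply/mapP; exists j; rewrite ?mem_enum.
move=> k; rewrite jordan_col -!tnth_nth !tnth_mktuple.
have [cb _] := hc _ (inc (blk k)).
have bs : block_size (blk k) = (nth b0 c (blk k)).2.1 by rewrite /block_size sE.
have ev : eigv (blk k) = (nth b0 c (blk k)).2.2 by rewrite /eigv sE.
have lk := pos_lt k.
have stepE : A (x k) = eigv (blk k) *: x k + shift A (eigv (blk k)) (x k).
  by rewrite /shift addrC subrK.
rewrite stepE; congr (_ + _); rewrite {1}/x -iterS.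
case: pickP => [j /andP [/eqP eb /eqP ep]|none].
  rewrite -tnth_nth tnth_mktuple /x eb.
  suff -> : ((block_size (blk k)).-1 - pos j = ((block_size (blk k)).-1 - pos k).+1)%N by [].
  by rewrite -ep in lk *; lia.
have p0 : pos k = 0%N.
  case ek: (pos k) => [//|p].
  have lp : (p < block_size (blk k))%N by rewrite ek in lk; apply: ltnW.
  have [j [jb jp]] := blk_pos_ex lp.
  by have := none j; rewrite jb jp ek !eqxx.
have [m0 km] := cb; rewrite p0 subn0 prednK ?bs // ev.
exact: km.
Qed.
End JordanForm.

(** * Ranks of powers *)

Section MatrixPowers.
Variable F : numFieldType.

Definition mxpow n (M : 'M[F]_n) k : 'M[F]_n := iter k (mulmx M) 1%:M.

Lemma mxpowSr n (M : 'M[F]_n) k : mxpow M k.+1 = mxpow M k *m M.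
Proof.
by elim: k => [|k IH]; rewrite /= ?mulmx1 ?mul1mx // -mulmxA -IH.
Qed.

Lemma mxpow_tr n (M : 'M[F]_n) k : mxpow M^T k = (mxpow M k)^T.
Proof.
elim: k => [|k IH]; first by rewrite /= trmx1.
by rewrite mxpowSr /= IH -trmx_mul.
Qed.

Lemma mul_mxdiag n (p_ : 'I_n -> nat) (D E : forall i, 'M[F]_(p_ i)) :
  \mxdiag_i D i *m \mxdiag_i E i = \mxdiag_i (D i *m E i).
Proof.
rewrite {2}/mxdiag mul_mxdiag_mxblock; apply/eq_mxblock => i j.
by case: eqVneq => [<-|_]; rewrite ?conform_mx_id ?mulmx0.
Qed.

Lemma mxpow_mxdiag n (p_ : 'I_n -> nat) (D : forall i, 'M[F]_(p_ i)) k :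
  mxpow (\mxdiag_i D i) k = \mxdiag_i mxpow (D i) k.
Proof.
elim: k => [|k IH]; first by rewrite /= mxdiagZ.
by rewrite /= IH mul_mxdiag.
Qed.

Lemma jordan_blockB n (a l : F) : jordan_block n a - l%:M = jordan_block n (a - l).
Proof.
by apply/matrixP => i j; rewrite !mxE mulrnBl addrAC -val_eqE.
Qed.

Lemma jordan_block_unit n (a : F) : a != 0 -> jordan_block n a \in unitmx.
Proof.
move=> a0; rewrite -unitmx_tr unitmxE det_trig.
  rewrite unitfE (eq_bigr (fun=> a)) ?prodr_const ?expf_neq0 // => i _.
  by rewrite !mxE eqxx gtn_eqF // addr0.
apply/is_trig_mxP => i j lt; rewrite !mxE.
by rewrite [j == i :> nat]gtn_eqF // [j.+1 == i]gtn_eqF ?addr0 // ltnW.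
Qed.

Lemma mxpow_jordan0 n k :
  mxpow (jordan_block n 0) k = \matrix_(i, j) ((i + k)%N == j)%:R :> 'M[F]_n.
Proof.
elim: k => [|k IH]; first by apply/matrixP => i j; rewrite !mxE addn0.
apply/matrixP => i j; rewrite /= IH !mxE.
have [lt|le] := ltnP i.+1 n.
  rewrite (bigD1 (Ordinal lt)) //= big1 => [|l ne].
    by rewrite !mxE eqxx mul0rn add0r mul1r addr0 addSnnS.
  by rewrite !mxE mul0rn add0r eq_sym -val_eqE /= in ne *; rewrite (negPf ne) mul0r.
rewrite big1 => [|l _]; last first.
  by rewrite !mxE mul0rn add0r gtn_eqF ?mul0r // (leq_trans (ltn_ord l)).
by rewrite gtn_eqF // addnS -addSn (leq_trans (ltn_ord j)) // (leq_trans le) ?leq_addr.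
Qed.

(** For a = 0 the power N has the entries delta_(i+k, j). Then N N^T is the projection
on the first n - k coordinates and N factors through this projection, which bounds
the rank from both sides. *)
Lemma rank_jordan_pow n (a : F) k :
  \rank (mxpow (jordan_block n a) k) = if a == 0 then (n - k)%N else n.
Proof.
have [->|a0] := eqVneq a 0; last first.
  apply: mxrank_unit; elim: k => [|k IH] /=; first exact: unitmx1.
  by rewrite unitmx_mul jordan_block_unit.
rewrite mxpow_jordan0; set N := \matrix_(i, j) _.
have NN : N *m N^T = pid_mx (n - k).
  apply/matrixP => i j; rewrite !mxE; have [lt|le] := ltnP (i + k) n.
    rewrite (bigD1 (Ordinal lt)) //= big1 => [|l ne].
      rewrite !mxE eqxx mul1r addr0 eqn_add2r eq_sym; congr (_%:R).
      by rewrite (_ : (i < n - k)%N) ?andbT ?ltn_subRL 1?addnC.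
    by rewrite !mxE eq_sym -val_eqE /= in ne *; rewrite (negPf ne) mul0r.
  rewrite big1 => [|l _]; last first.
    by rewrite !mxE gtn_eqF ?mul0r // (leq_trans (ltn_ord l)).
  by rewrite [(i < n - k)%N]ltn_subRL addnC ltnNge le andbF.
have NP : pid_mx (n - k) *m N = N.
  apply/matrixP => i j; rewrite mxE (bigD1 i) //= big1 => [|l ne].
    rewrite !mxE eqxx /= addr0 ltn_subRL addnC; case: ltnP => le; first by rewrite mul1r.
    by rewrite mul0r gtn_eqF // (leq_trans (ltn_ord j)).
  by rewrite !mxE eq_sym val_eqE (negPf ne) mul0r.
have rp : \rank (pid_mx (n - k) : 'M[F]_n) = (n - k)%N.
  by apply: rank_pid_mx; rewrite leq_subr.
apply/eqP; rewrite eqn_leq -{1}NP (leq_trans (mxrankM_maxl _ _)) ?rp //=.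
by rewrite -[X in (X <= _)%N]rp -NN mxrankM_maxl.
Qed.

Lemma rank_jordan_mx (s : seq (nat * F)) (l : F) k :
  \rank (mxpow (jordan_mx s - l%:M) k) =
  (\sum_(b <- s) if b.2 == l then (b.1 - k)%N else b.1)%N.
Proof.
rewrite /jordan_mx -[l%:M]mxdiagZ -mxdiagB mxpow_mxdiag rank_mxdiag.
rewrite (big_tnth _ _ s); apply: eq_bigr => i _.
by rewrite jordan_blockB rank_jordan_pow subr_eq0.
Qed.

(** A block of size n for l contributes n - k (or 0 if n < k) to the rank of the k-th
power, and the second difference of this function of k is 1 at k = n and 0
elsewhere; the other blocks contribute a constant. *)
Lemma nb_blocks_rank (s : seq (nat * F)) (l : F) m :
  (nb_blocks s m.+1 l + 2 * \rank (mxpow (jordan_mx s - l%:M) m.+1) =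
  \rank (mxpow (jordan_mx s - l%:M) m) + \rank (mxpow (jordan_mx s - l%:M) m.+2))%N.
Proof.
rewrite !rank_jordan_mx /nb_blocks; elim: s => [|[n a] s IH]; first by rewrite !big_nil.
rewrite !big_cons /= xpair_eqE; move: IH.
set A := (\sum_(_ <- _) _)%N; set B := (\sum_(_ <- _) _)%N; set C := (\sum_(_ <- _) _)%N.
set D := count _ _ => IH.
case: (a == l); rewrite ?andbT ?andbF /=; last by lia.
by case: (n =P m.+1) => [->|ne] /=; lia.
Qed.

(** Choose r = rank A independent rows of A. By skew symmetry, the principal submatrix C
with these rows and columns still has rank r; and an invertible skew matrix C has
det C = det C^T = (-1)^r det C. *)
Lemma skew_rank_even n (A : 'M[F]_n) : A^T = - A -> ~~ odd (\rank A).
Proof.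
move=> skew; pose f := maxrankfun A; pose B := rowsub f A; pose C := colsub f B.
have [X AX] : exists X, A = X *m B.
  by apply/submxP; rewrite eq_maxrowsub.
have BC : B = - (C^T *m X^T).
  have e : A = - (B^T *m X^T) by rewrite -trmx_mul -AX skew opprK.
  apply/matrixP => i j; have /matrixP /(_ (f i) j) := e; rewrite !mxE => ->.
  by congr (- _); apply: eq_bigr => k _; rewrite !mxE.
have rC : \rank C = \rank A.
  apply/eqP; rewrite eqn_leq rank_leq_row /=.
  rewrite -[X in (X <= _)%N](eqP (maxrowsub_free A)) -/f -/B {1}BC.
  by rewrite -mulNmx (leq_trans (mxrankM_maxl _ _)) // mxrank_opp mxrank_tr.
have uC : C \in unitmx by rewrite -row_full_unit /row_full rC.
have CT : C^T = - C.
  by apply/matrixP => i j; have /matrixP /(_ (f i) (f j)) := skew; rewrite !mxE.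
have := det_tr C; rewrite CT -scaleN1r detZ => h.
apply/negP => odd_r; move: h; rewrite -signr_odd odd_r expr1 mulN1r => /eqP.
rewrite -subr_eq0 -opprD oppr_eq0 -mulr2n mulrn_eq0 /=.
by apply/negP; rewrite -unitfE -unitmxE.
Qed.

End MatrixPowers.

(** * Jordan blocks of an endomorphism preserving a two-form *)

Definition sympl_blocks (F : fieldType) (s : seq (nat * F)) :=
  (forall (m : nat) (lambda : F), lambda != 0 ->
     nb_blocks s m lambda = nb_blocks s m (- lambda)) /\
  (forall m : nat, (0 < m)%N -> ~~ odd (nb_blocks s (2 * m - 1) 0)).

Lemma mxrank_mulmx_unit (F : fieldType) m n (P : 'M[F]_(m, n)) (O : 'M[F]_n) :
  O \in unitmx -> \rank (P *m O) = \rank P.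
Proof.
move=> uO; apply/eqP; rewrite eqn_leq mxrankM_maxl /=.
by rewrite -{1}(mulmxK uO P) mxrankM_maxl.
Qed.

Section SymplBlocks.
Variables (F : numFieldType) (U : vectType F) (A : 'End(U)) (s : seq (nat * F)).
Hypothesis jnf : jordan_normal_form A s.
Local Notation n := (\sum_i block_size (s := s) i)%N.

Lemma nb_blocks0 (l : F) : nb_blocks s 0 l = 0%N.
Proof.
case: jnf => h _; apply/eqP; rewrite -leqn0 leqNgt -has_count; apply/hasPn => p ps.
by apply: contraTneq (allP h _ ps) => ->.
Qed.

(** If M is the Jordan matrix and O the Gram matrix of the preserved two-form in a
Jordan basis, then M^T O = - O M. So (M - l)^k and (M + l)^k have the same rank, and
(M^T)^(2j) O is skew, so that M^(2j) has even rank. The conclusions are read off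
from [nb_blocks_rank]. *)
Lemma preserves_sympl_blocks : preserves_sympl A -> sympl_blocks s.
Proof.
move=> [w [wxx nd] wA]; have [s0 [X bX hX]] := jnf.
have bw := biscalar_bilin w; have anti := bilin_alt_anti bw wxx.
pose M := jordan_mx s; pose O := \matrix_(i < n, j < n) w X`_i X`_j.
have OT : O^T = - O by apply/matrixP => i j; rewrite !mxE anti.
have MO : M^T *m O = - (O *m M).
  apply/matrixP => i j; apply/eqP; rewrite !mxE -addr_eq0.
  apply/eqP; apply: (etrans _ (wA X`_i X`_j)); rewrite !hX.
  rewrite (bilin_suml bw) (bilin_sumr bw); congr (_ + _); apply: eq_bigr => k _.
    by rewrite !mxE.
  by rewrite !mxE mulrC.
have uO : O \in unitmx.
  rewrite unitmxE unitfE; apply/det0P => -[v v0 vO].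
  have /freeP fX := basis_free bX.
  case/eqP: v0; apply/rowP => i; rewrite mxE; move: i; apply: fX.
  apply: nd; rewrite ?memvf // => y _.
  rewrite (coord_basis bX (memvf y)) (bilin_sumr bw) big1 // => j _.
  have /rowP /(_ j) := vO; rewrite !mxE (bilin_suml bw) => h.
  rewrite [X in _ * X](_ : _ = 0) ?mulr0 // -[RHS]h.
  by apply: eq_bigr => i _; rewrite mxE.
have pow (l : F) k : mxpow (M - l%:M)^T k *m O = (-1) ^+ k *: (O *m mxpow (M + l%:M) k).
  have e1 : (M - l%:M)^T *m O = - (O *m (M + l%:M)).
    rewrite linearB /= tr_scalar_mx mulmxBl MO mulmxDr mul_scalar_mx mul_mx_scalar.
    by rewrite opprD.
  elim: k => [|k IH]; first by rewrite /= expr0 scale1r mul1mx mulmx1.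
  rewrite mxpowSr -mulmxA e1 mulmxN mulmxA IH -scalemxAl -mulmxA -mxpowSr.
  by rewrite exprS mulN1r scaleNr.
have rk (l : F) k : \rank (mxpow (M - l%:M) k) = \rank (mxpow (M - (- l)%:M) k).
  rewrite -mxrank_tr -mxpow_tr -(mxrank_mulmx_unit _ uO) pow.
  rewrite mxrank_scale_nz ?signr_eq0 // raddfN opprK.
  by rewrite -mxrank_tr trmx_mul mxrank_mulmx_unit ?unitmx_tr // mxrank_tr.
split=> [[|m] l _|m m0]; first by rewrite !nb_blocks0.
  have := nb_blocks_rank s (- l) m; rewrite -/M => e1.
  by have := nb_blocks_rank s l m; rewrite -/M (rk l m) (rk l m.+1) (rk l m.+2) -e1 => /addIn.
have even_rank k : ~~ odd (\rank (mxpow (M - 0%:M) (2 * k))).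
  rewrite -mxrank_tr -mxpow_tr -(mxrank_mulmx_unit _ uO); apply: skew_rank_even.
  rewrite [RHS](congr1 -%R (pow _ _)) trmx_mul OT mxpow_tr trmxK.
  by rewrite exprM sqrrN expr1n expr1n scale1r raddf0 subr0 addr0 mulNmx.
have -> : (2 * m - 1 = (2 * m.-1).+1)%N by case: m m0 => // m _; lia.
have := congr1 odd (nb_blocks_rank s 0 (2 * m.-1)).
have -> : ((2 * m.-1).+2 = 2 * m)%N by case: m m0 => // m _; lia.
rewrite oddD [(2 * \rank _)%N]mul2n odd_double addbF oddD -/M.
by rewrite (negPf (even_rank m.-1)) (negPf (even_rank m)) => ->.
Qed.

End SymplBlocks.

(** * A preserved two-form from matching Jordan blocks *)

Section Matching.
Variables (T : finType) (K : eqType) (key : T -> K) (sg : K -> K) (P : pred K).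

Definition fiber (k : K) : seq T := enum [pred t | key t == k].

Lemma mem_fiber t : t \in fiber (key t).
Proof. by rewrite mem_enum inE. Qed.

Lemma fiberP k t : (t \in fiber k) = (key t == k).
Proof. by rewrite mem_enum inE. Qed.

(** The involution which exchanges 2i and 2i + 1. *)
Definition swap_pair (r : nat) := if odd r then r.-1 else r.+1.

Lemma swap_pairK : involutive swap_pair.
Proof.
move=> r; rewrite /swap_pair; case o: (odd r); case: r o => //= r.
  by move=> /negbTE ->.
by move=> ->.
Qed.

Lemma swap_pair_neq r : swap_pair r != r.
Proof.
rewrite /swap_pair; case: ifP => o; last by rewrite gtn_eqF.
by case: r o => // r _; rewrite ltn_eqF.
Qed.

Lemma swap_pair_lt r m : ~~ odd m -> (r < m)%N -> (swap_pair r < m)%N.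
Proof.
rewrite /swap_pair => em lt; case: ifP => o; first exact: leq_ltn_trans (leq_pred _) lt.
rewrite ltn_neqAle lt andbT; apply/eqP => e.
by move: em; rewrite -e /= o.
Qed.

(** Match t with the element of the same rank in the fiber of the opposite key. In a
fiber which is its own opposite this would fix every t; if P holds there, the
ranks are exchanged in consecutive pairs, and the last rank has a partner since
the size of the fiber is even. *)
Lemma matching_exists :
  (forall k, sg (sg k) = k) -> (forall k, size (fiber k) = size (fiber (sg k))) ->
  (forall k, sg k = k -> P k -> ~~ odd (size (fiber k))) ->
  exists pi : T -> T, [/\ involutive pi, forall t, key (pi t) = sg (key t) &
    forall t, sg (key t) = key t -> P (key t) -> pi t != t].
Proof.
move=> sgK szE szP.
pose rk t := index t (fiber (key t)).
have rk_lt t : (rk t < size (fiber (key t)))%N by rewrite index_mem mem_fiber.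
pose tr t := if (sg (key t) == key t) && P (key t) then swap_pair (rk t) else rk t.
have tr_lt t : (tr t < size (fiber (sg (key t))))%N.
  rewrite /tr; case: ifP => [/andP [/eqP e p]|_]; last by rewrite -szE.
  by rewrite e swap_pair_lt // szP.
pose pi t := nth t (fiber (sg (key t))) (tr t).
have key_pi t : key (pi t) = sg (key t).
  by apply/eqP; rewrite -fiberP mem_nth.
have rk_pi t : rk (pi t) = tr t.
  by rewrite /rk key_pi index_uniq ?enum_uniq.
have tr_pi t : tr (pi t) = rk t.
  rewrite {1}/tr key_pi rk_pi sgK /tr [key t == _]eq_sym.
  have [-> /=|_ //] := eqVneq (sg (key t)) (key t).
  by case: (P _); rewrite ?swap_pairK.
exists pi; split=> // [t|t e p].
  rewrite {1}/pi key_pi sgK tr_pi (set_nth_default t) ?rk_lt // nth_index //.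
  exact: mem_fiber.
apply/eqP => pit; have := rk_pi t; rewrite pit /tr e eqxx p /= => /esym /eqP.
by rewrite (negPf (swap_pair_neq _)).
Qed.

End Matching.

Section SymplFromBlocks.
Variables (F : numFieldType) (U : vectType F) (A : 'End(U)) (s : seq (nat * F)).
Hypothesis jnf : jordan_normal_form A s.
Local Notation n := (\sum_i block_size (s := s) i)%N.

(** Apply [matching_exists] to the map which negates the eigenvalue. Only blocks with
eigenvalue 0 have a key which is its own opposite. *)
Lemma block_matching : sympl_blocks s ->
  exists pi : 'I_(size s) -> 'I_(size s),
  [/\ involutive pi, forall i, block_size (pi i) = block_size i,
      forall i, eigv (pi i) = - eigv i &
      forall i, odd (block_size i) -> pi i != i].
Proof.
case=> [h1 h2].
pose key := tnth (in_tuple s).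
pose sg (k : nat * F) := (k.1, - k.2).
have fE k : size (fiber key k) = nb_blocks s k.1 k.2.
  transitivity (count_mem k [seq key i | i <- enum 'I_(size s)]).
    by rewrite count_map -size_filter enumT.
  by rewrite /nb_blocks map_tnth_enum; case: k.
have [||k e ok|pi [piK kpi npi]] := @matching_exists _ _ key sg (fun k => odd k.1).
- by case=> m a; rewrite /sg /= opprK.
- case=> m a; rewrite !fE /=; have [->|a0] := eqVneq a 0; first by rewrite oppr0.
  exact: h1.
- rewrite fE; have k0 : k.2 = 0.
    have : - k.2 = k.2 by move: e; rewrite /sg; case: (k) => m a [].
    move/eqP; rewrite eq_sym -addr_eq0 -mulr2n mulrn_eq0 => /eqP ->//.
  have -> : k.1 = (2 * (k.1./2).+1 - 1)%N.
    have := odd_double_half k.1; rewrite ok -mul2n; lia.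
  by rewrite k0 h2.
exists pi; split=> // i.
- by rewrite /block_size -/(key _) kpi.
- by rewrite /eigv -/(key _) kpi.
move=> oi; have [e|ne] := eqVneq (eigv i) 0.
  apply: npi => //; rewrite /sg -/(eigv i) e oppr0 -e.
  by rewrite /eigv -/(key i); case: (key i).
apply: contraNneq ne => pii; have : eigv (pi i) = - eigv i by rewrite /eigv -/(key _) kpi.
by rewrite pii => /eqP; rewrite -addr_eq0 -mulr2n mulrn_eq0.
Qed.

(** The vector at position p of block i is paired with the one at position m - 1 - p of
block pi i, the value being [ep i] (-1)^p. The eigenvalues of the two blocks cancel,
and the nilpotent parts cancel because of the alternating signs. *)
Lemma blocks_preserve_sympl : sympl_blocks s -> preserves_sympl A.
Proof.
move=> /block_matching [pi [piK bpi epi npi]]; have [s0 [X bX hX]] := jnf.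
(* For odd sizes the alternating signs alone would give a symmetric pairing of the two
     matched blocks; so one of them, the one of larger index, gets a minus sign. *)
pose ep (i : 'I_(size s)) : F := if odd (block_size i) && (pi i < i)%N then -1 else 1.
have ep_pi i : ep (pi i) = (-1) ^+ (block_size i) * ep i.
  rewrite /ep bpi piK -signr_odd; case o: (odd _); last by rewrite mul1r.
  have := npi i o; rewrite -val_eqE /= neq_ltn expr1.
  by case: ltngtP => //= _ _; rewrite ?mulN1r ?opprK.
have ep0 i : ep i != 0 by rewrite /ep; case: ifP; rewrite ?oppr_eq0 oner_eq0.
have tau_ex (j : 'I_n) : exists k : 'I_n,
    blk k = pi (blk j) /\ pos k = ((block_size (blk j)).-1 - pos j)%N.
  apply: blk_pos_ex; rewrite bpi; have := pos_lt j; lia.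
have [tau tauE] := choice tau_ex.
have tauK : involutive tau.
  move=> j; have [b1 p1] := tauE j; have [b2 p2] := tauE (tau j).
  apply: blk_pos_inj; first by rewrite b2 b1 piK.
  by rewrite p2 p1 b1 bpi; have := pos_lt j; lia.
pose eta j := ep (blk j) * (-1) ^+ pos j.
have eta0 j : eta j != 0 by rewrite mulf_neq0 ?signr_eq0.
have eta_tau j : eta (tau j) = - eta j.
  have [b1 p1] := tauE j; rewrite /eta b1 p1 ep_pi.
  set q := (_ - _)%N; have -> : block_size (blk j) = (q + pos j).+1.
    by rewrite /q; have := pos_lt j; lia.
  have sq : (-1) ^+ q * (-1) ^+ q = 1 :> F by rewrite -expr2 sqrr_sign.
  rewrite exprS exprD; move: (ep _) (_ ^+ q) (_ ^+ pos j) sq => a b c sq.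
  by transitivity (- (a * c) * (b * b)); [ring|rewrite sq mulr1].
pose f x y := \sum_j coord X j x * eta j * coord X (tau j) y.
have bf : bilin f.
  split=> a x y z; rewrite /f big_distrr /= -big_split; apply: eq_bigr => j _ /=;
  rewrite linearP /=; ring.
have fskew x y : f x y = - f y x.
  rewrite /f (reindex_inj (inv_inj tauK)) /= -sumrN; apply: eq_bigr => j _.
  by rewrite eta_tau tauK; ring.
have fxx x : f x x = 0.
  by apply/eqP; have /eqP := fskew x x; rewrite -addr_eq0 -mulr2n mulrn_eq0.
have fX (j k : 'I_n) : f X`_j X`_k = (k == tau j)%:R * eta j.
  rewrite /f (bigD1 j) //= (@big1 F) => [|l ne].
    rewrite !coord_free ?(basis_free bX) // eqxx mul1r addr0 mulrC.
    by rewrite eq_sym.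
  by rewrite coord_free ?(basis_free bX) // eq_sym (negPf ne) !mul0r.
have [w wE] := bilin_biscalar bf.
exists w.
  split=> [x|x _ h]; first by rewrite wE.
  rewrite (coord_basis bX (memvf x)) big1 // => j _.
  have := h X`_(tau j) (memvf _); rewrite wE /f (bigD1 j) //= (@big1 F) => [|l ne].
    rewrite coord_free ?(basis_free bX) // eqxx mulr1 addr0 => /eqP.
    by rewrite mulf_eq0 (negPf (eta0 j)) orbF => /eqP ->; rewrite scale0r.
  by rewrite coord_free ?(basis_free bX) // (inj_eq (inv_inj tauK)) eq_sym (negPf ne) mulr0.
have AX (j k : 'I_n) : f (A X`_j) X`_k + f X`_j (A X`_k) = 0.
  rewrite !hX (bilin_suml bf) (bilin_sumr bf) (bigD1 (tau k)) //= (@big1 F) => [|l ne].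
    rewrite (bigD1 (tau j)) //= (@big1 F) => [|l ne].
      rewrite !addr0 !fX tauK !eqxx !mul1r eta_tau !jordan_mxE.
      have [bj pj] := tauE j; have [bk pk] := tauE k; rewrite bj bk.
      have -> : (pi (blk j) == blk k) = (pi (blk k) == blk j).
        by rewrite -(inj_eq (inv_inj piK)) piK eq_sym.
      have [e|_] := eqVneq (pi (blk k)) (blk j); last by rewrite !mul0r addr0.
      have em : block_size (blk j) = block_size (blk k) by rewrite -e bpi.
      have := pos_lt j; have := pos_lt k; rewrite pj pk em => ltk ltj.
      set m := block_size (blk k) in ltk ltj *.
      have -> : (m.-1 - pos j == pos k)%N = (m.-1 - pos k == pos j)%N.
        by apply/eqP/eqP; lia.
      have -> : ((m.-1 - pos j).+1 == pos k)%N = ((m.-1 - pos k).+1 == pos j)%N.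
        by apply/eqP/eqP; lia.
      rewrite -e epi !mul1r.
      have [e1|_] := eqVneq (m.-1 - pos k)%N (pos j).
        have -> : eta j = - eta k.
          rewrite -eta_tau; congr eta; apply: blk_pos_inj; first by rewrite bk.
          by rewrite pk -e1.
        by rewrite -e1 gtn_eqF // !mulr1n !mulr0n; ring.
      rewrite !mulr0n; case: eqP => [e2|_]; last by rewrite mulr0n; ring.
      have -> : eta j = eta k; last by rewrite mulr1n; ring.
      have sq : (-1) ^+ pos j * (-1) ^+ pos j = 1 :> F by rewrite -expr2 sqrr_sign.
      rewrite /eta -e ep_pi -/m (_ : m = pos k + pos j)%N; last by lia.
      rewrite exprD; move: (ep _) (_ ^+ pos j) (_ ^+ pos k) sq => a b c sq.
      by transitivity (a * c * (b * b)); [ring|rewrite sq mulr1].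
    by rewrite fX (negPf ne) mul0r mulr0.
  by rewrite fX -(inj_eq (inv_inj tauK)) tauK eq_sym (negPf ne) mul0r mulr0.
pose h x y := f (A x) y + f x (A y).
have bh : bilin h by split=> a x y z; rewrite /h linearP ?bf.1 ?bf.2; ring.
move=> x y; rewrite !wE -/(h x y) (coord_basis bX (memvf x)) (coord_basis bX (memvf y)).
rewrite (bilin_suml bh) (@big1 F) // => j _.
rewrite (bilin_sumr bh) (@big1 F) ?mulr0 // => k _.
by rewrite /h AX mulr0.
Qed.

End SymplFromBlocks.

(** * The equivalences *)

Theorem theorem1p2 (R : realType) (g : vectType R[i])
  (br : {bilinear g -> g -> g}) (u : {vspace g}) (e7 : g)
  (omega : {biscalar (subvs_of u)})
  (hbr : is_lie_bracket br) (hg : \dim {:g} = 7%N)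
  (hu : abelian_ideal br u) (hcodim : (\dim u).+1 = \dim {:g})
  (he7 : e7 \notin u) (homega : nondegenerate_2form omega) :
  ((exists (phi : kform g 3) (vol : kform g 7) (gC : {biscalar g})
      (star_phi : kform g 4),
      cocalibrated_G2C_structure br phi vol gC star_phi /\ nondegenerate_on gC u)
   <->
   (exists2 f : 'End(subvs_of u), in_sp omega f & similar_end (ad_on br e7 u) f))
  /\
  ((exists2 f : 'End(subvs_of u), in_sp omega f & similar_end (ad_on br e7 u) f)
   <->
   (exists2 s : seq (nat * R[i]), jordan_normal_form (ad_on br e7 u) s &
      (forall (m : nat) (lambda : R[i]), lambda != 0 ->
         nb_blocks s m lambda = nb_blocks s m (- lambda)) /\
      (forall m : nat, (0 < m)%N -> ~~ odd (nb_blocks s (2 * m - 1) 0)))).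
Proof.
have bS := similar_sp_iff (ad_on br e7 u) homega.
split.
  split=> [a|/bS b]; first exact/bS/(cocalibrated_preserves_sympl hbr.1 hu hcodim he7 hg).
  exact: (preserves_sympl_cocalibrated hbr.1 hu hcodim he7 hg).
split=> [/bS b|[s js cs]]; last exact/bS/(blocks_preserve_sympl js).
have [s js] := jordan_form_exists (ad_on br e7 u).
by exists s => //; apply: (preserves_sympl_blocks js).
Qed.
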